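(* Let $D$ and $D'$ be long virtual knot diagrams, each with at least one classical crossing. If $D$ and $D'$ are equivalent (i.e. represent the same long virtual knot), then there is an integer $r$ such that $$\zeta(D')=q^{r}\,\zeta(D)\quad\text{in } T[s,s^{-1}],$$ where $T=\mathbb{Z}[p,p^{-1},q,q^{-1}]/\big((p-1)(p-q),\,(q-1)(p-q)\big)$ and $\zeta$ is the determinant polynomial defined in the context.
   Context: **Long virtual knots.** A long virtual knot diagram is a smooth immersion $f:\mathbb{R}\to\mathbb{R}^2$ such that (1) outside some big circle $f(t)=(t,0)$; (2) each intersection point is double and transverse; (3) each intersection point is endowed either with a classical crossing structure (a choice of overpass and underpass) or with a virtual crossing structure. The diagram is oriented by increasing $t$. Two diagrams are equivalent, i.e. represent the same long virtual knot, if they are related by planar isotopy and a finite sequence of generalized Reidemeister moves: the classical moves $\Omega_1,\Omega_2,\Omega_3$, their purely virtual versions $\Omega_1',\Omega_2',\Omega_3'$, and the semivirtual move $\Omega'$ (a third move with one classical and two virtual crossings, moving a strand with two consecutive virtual crossings past a classical crossing). **Arcs and long arcs.** An arc of a diagram is a connected component of the set obtained from the diagram by deleting all virtual crossings, where at each classical crossing the two undercrossing edges are regarded as disjoint from each other (as usually drawn), while the overcrossing strand is not broken. Two arcs $a,a'$ belong to the same long arc if there are arcs $a=a_1,\dots,a_{m+1}=a'$ and virtual crossings $c_1,\dots,c_m$ such that $a_i,a_{i+1}$ are incident to $c_i$ from opposite sides for $i=1,\dots,m$. The initial long arc $\gamma_-$ (coming from $t=-\infty$) and the final long arc $\gamma_+$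 (going to $t=+\infty$) are regarded as forming one united long arc $\gamma=\gamma_-\cup\gamma_+$, traversed along $\gamma_+$ first and then along $\gamma_-$. Hence, for a diagram $D$ with $n\ge 1$ classical crossings, there are exactly $n$ long arcs, and each classical crossing $v$ is paired with the long arc emanating from $v$ (the one starting at the outgoing underpass edge at $v$). Number the classical crossings $v_1,\dots,v_n$ in any way and let $\gamma^j$ be the long arc emanating from $v_j$. **Early over/undercrossings.** A classical crossing $v$ is an early overcrossing (respectively early undercrossing) if, traversing the diagram by increasing $t$, the first passage through $v$ is along its overpass (respectively underpass). **Incidence coefficients.** For a classical crossing $v$ and an arc $a$, define $$[v:a]=\varepsilon_1\cdot 1+\varepsilon_2\,(t^{\operatorname{sgn} v}-1)+\varepsilon_3\,(-t^{\operatorname{sgn} v})\in T,$$ where $t=p$ if $v$ is an early overcrossing and $t=q$ if $v$ is an early undercrossing; $\operatorname{sgn} v\in\{\pm1\}$ is the local writhe number of $v$; and $\varepsilon_i\in\{0,1\}$ with $\varepsilon_1=1$ iff $a$ emanates from $v$ (outgoing underpass edge), $\varepsilon_2=1$ iff $a$ passes over $v$, $\varepsilon_3=1$ iff $a$ comes into $v$ (incoming underpass edge). If $v$ and $a$ are not incident, $[v:a]=0$. **Degrees of arcs.** The function $\deg:\{\text{arcs of }D\}\to\mathbb{Z}$ is defined by: (1) $\deg a=0$ if $a$ is the first arc of its long arc; (2) if $a,b$ are neighbouring arcs on a long arc, separated by a virtual crossing, with $a$ preceding $b$, then $\deg b=\deg a+1$ if passing from $a$ to $b$ one crosses the (oriented)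 transversal strand from its left to its right, and $\deg b=\deg a-1$ otherwise. For the united long arc $\gamma$, the first arc is the first arc of $\gamma_+$, and the last arc of $\gamma_+$ and the first arc of $\gamma_-$ have the same degree. **The polynomial.** Let $A(D)$ be the $n\times n$ matrix with entries $$A_{ij}=\sum_{a\subset\gamma^j}[v_i:a]\,s^{\deg a}\in T[s,s^{-1}],$$ the sum running over the arcs $a$ contained in $\gamma^j$, and put $\zeta(D)=\det A(D)\in T[s,s^{-1}]$. This does not depend on the numbering of the classical crossings. *)

(* Defs.v *)
From HB Require Import structures.
From Stdlib Require Import Relation_Operators.
From mathcomp Require Import all_boot all_fingroup all_algebra.
From mathcomp Require Import finmap boolp.
From mathcomp Require Import monalg.

Set Implicit Arguments.
Unset Strict Implicit.
Unset Printing Implicit Defensive.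

Import GRing.Theory.
Local Open Scope ring_scope.

(******************************************************************************)
(* Laurent polynomials.  An element of [laurent R] is a finitely supported    *)
(* family of coefficients indexed by int; << c *g k >> is c X^k and f@_k is   *)
(* the coefficient of X^k in f.  (monalg only makes {malg R[K]} a ring when   *)
(* the monoid K has no invertible elements, which excludes int.)              *)
(******************************************************************************)

Definition laurent (R : nzRingType) : Type := {malg R[int]}.

HB.instance Definition _ (R : nzRingType) := GRing.Lmodule.on (laurent R).

Section LaurentRing.
Variable R : comNzRingType.
Implicit Types f g h : laurent R.

Definition laurent_mul_def f g : laurent R :=
  \sum_(i <- msupp f) \sum_(j <- msupp g) << f@_i * g@_j *g i + j >>.

Fact laurent_key : unit. Proof. by []. Qed.
Definition laurent_mul := locked_with laurent_key laurent_mul_def.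
Canonical laurent_mul_unlockable := [unlockable fun laurent_mul].

Lemma laurent_mulw (d1 d2 : {fset int}) f g :
  (msupp f `<=` d1)%fset -> (msupp g `<=` d2)%fset ->
  laurent_mul f g = \sum_(i <- d1) \sum_(j <- d2) << f@_i * g@_j *g i + j >>.
Proof.
move=> le1 le2; rewrite unlock (big_fset_incl _ le1) /=.
  apply: eq_bigr => i _; apply/big_fset_incl => // j _ /mcoeff_outdom ->.
  by rewrite mulr0 monalgU0.
move=> i _ /mcoeff_outdom fi; rewrite big1 // => j _.
by rewrite fi mul0r monalgU0.
Qed.

Lemma laurent_mulC : commutative laurent_mul.
Proof.
move=> f g; rewrite unlock exchange_big /=.
by apply: eq_bigr => i _; apply: eq_bigr => j _; rewrite mulrC addrC.
Qed.

Lemma laurent_mulDl : left_distributive laurent_mul +%R.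
Proof.
move=> f1 f2 g.
rewrite (laurent_mulw (msuppD_le _ _) (fsubset_refl _)).
rewrite (laurent_mulw (fsubsetUl _ (msupp f2)) (fsubset_refl _)).
rewrite (laurent_mulw (fsubsetUr (msupp f1) _) (fsubset_refl _)).
rewrite -big_split /=; apply: eq_bigr => i _.
rewrite -big_split /=; apply: eq_bigr => j _.
by rewrite mcoeffD mulrDl monalgUD.
Qed.

Lemma laurent_mulDr : right_distributive laurent_mul +%R.
Proof. by move=> f g h; rewrite !(laurent_mulC f) laurent_mulDl. Qed.

Lemma laurent_mul0g : left_zero 0 laurent_mul.
Proof. by move=> g; rewrite unlock msupp0 big_seq_fset0. Qed.

Lemma laurent_mulg0 : right_zero 0 laurent_mul.
Proof. by move=> g; rewrite laurent_mulC laurent_mul0g. Qed.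

Lemma laurent_mulUU a b k l :
  laurent_mul << a *g k >> << b *g l >> = << a * b *g k + l >>.
Proof.
by rewrite (laurent_mulw msuppU_le msuppU_le) !big_seq_fset1 !mcoeffUU.
Qed.

Lemma laurent_mulE f g : laurent_mul f g =
  \sum_(i <- msupp f) \sum_(j <- msupp g)
     laurent_mul << f@_i *g i >> << g@_j *g j >>.
Proof.
rewrite [LHS](laurent_mulw (fsubset_refl _) (fsubset_refl _)).
by apply: eq_bigr => i _; apply: eq_bigr => j _; rewrite laurent_mulUU.
Qed.

Lemma laurent_mulsl (I : Type) (r : seq I) F g :
  laurent_mul (\sum_(i <- r) F i) g = \sum_(i <- r) laurent_mul (F i) g.
Proof.
exact: (big_morph (laurent_mul^~ g) (fun _ _ => laurent_mulDl _ _ _)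
  (laurent_mul0g _)).
Qed.

Lemma laurent_mulsr (I : Type) (r : seq I) F f :
  laurent_mul f (\sum_(i <- r) F i) = \sum_(i <- r) laurent_mul f (F i).
Proof.
by rewrite laurent_mulC laurent_mulsl; apply: eq_bigr => i _; rewrite laurent_mulC.
Qed.

Lemma laurent_mulA : associative laurent_mul.
Proof.
have mU2 a b i j h : laurent_mul << a *g i >> (laurent_mul << b *g j >> h)
    = laurent_mul (laurent_mul << a *g i >> << b *g j >>) h.
  rewrite [h]monalgE (laurent_mulsr _ _ << b *g j >>).
  rewrite (laurent_mulsr _ _ << a *g i >>) (laurent_mulsr _ _ (laurent_mul _ _)).
  by apply: eq_bigr => k _; rewrite !laurent_mulUU mulrA addrA.
have mU1 a i g h : laurent_mul << a *g i >> (laurent_mul g h)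
    = laurent_mul (laurent_mul << a *g i >> g) h.
  rewrite [g]monalgE (laurent_mulsl _ _ h) !(laurent_mulsr _ _ << a *g i >>).
  by rewrite (laurent_mulsl _ _ h); apply: eq_bigr => j _; exact: mU2.
move=> f g h; rewrite [f]monalgE (laurent_mulsl _ _ g) (laurent_mulsl _ _ h).
rewrite (laurent_mulsl _ _ (laurent_mul g h)).
by apply: eq_bigr => i _; exact: mU1.
Qed.

Lemma laurent_mul1g : left_id (<< 1 *g 0 >> : laurent R) laurent_mul.
Proof.
move=> g; rewrite [g in LHS]monalgE laurent_mulsr [RHS]monalgE.
by apply: eq_bigr => i _; rewrite laurent_mulUU mul1r add0r.
Qed.

Lemma laurent_1neq0 : << 1 *g 0 >> != 0 :> laurent R.
Proof. by rewrite monalgU_eq0 oner_eq0. Qed.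

HB.instance Definition _ := GRing.Zmodule_isComNzRing.Build (laurent R)
  laurent_mulA laurent_mulC laurent_mul1g laurent_mulDl laurent_1neq0.

Lemma laurent_scaleE (c : R) f : c *: f = (<< c *g 0 >> : laurent R) * f.
Proof.
rewrite [f in RHS]monalgE [RHS]laurent_mulsr malgZ_def.
by apply: eq_bigr => i _; rewrite laurent_mulUU add0r.
Qed.

Lemma laurent_scaleAl (c : R) f g : c *: (f * g) = (c *: f) * g.
Proof. by rewrite !laurent_scaleE mulrA. Qed.

HB.instance Definition _ :=
  GRing.Lmodule_isLalgebra.Build R (laurent R) laurent_scaleAl.

(* The value of f at X = 1. *)
Definition laurent_at1 f : R := \sum_(k <- msupp f) f@_k.

Lemma laurent_at1w (d : {fset int}) f :
  (msupp f `<=` d)%fset -> laurent_at1 f = \sum_(k <- d) f@_k.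
Proof.
by move=> le; apply/big_fset_incl => // k _ /mcoeff_outdom.
Qed.

Lemma laurent_at1D : {morph laurent_at1 : f g / f + g}.
Proof.
move=> f g; rewrite (laurent_at1w (msuppD_le _ _)).
rewrite (laurent_at1w (fsubsetUl _ (msupp g))).
rewrite (laurent_at1w (fsubsetUr (msupp f) _)) -big_split /=.
by apply: eq_bigr => k _; rewrite mcoeffD.
Qed.

Lemma laurent_at1_0 : laurent_at1 0 = 0.
Proof. by rewrite /laurent_at1 msupp0 big_seq_fset0. Qed.

Lemma laurent_at1U c k : laurent_at1 << c *g k >> = c.
Proof. by rewrite (laurent_at1w msuppU_le) big_seq_fset1 mcoeffUU. Qed.

Lemma laurent_at1M : {morph laurent_at1 : f g / f * g}.
Proof.
move=> f g; rewrite [f * g](laurent_mulw (fsubset_refl _) (fsubset_refl _)).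
rewrite (big_morph _ laurent_at1D laurent_at1_0) mulr_suml.
apply: eq_bigr => i _; rewrite (big_morph _ laurent_at1D laurent_at1_0) mulr_sumr.
by apply: eq_bigr => j _; rewrite laurent_at1U.
Qed.

End LaurentRing.

(******************************************************************************)
(* T = Z[p^-1, p, q^-1, q] / ((p - 1)(p - q), (q - 1)(p - q)).                *)
(******************************************************************************)

Definition Zpq : comNzRingType := laurent (laurent int).

Definition Zpq_p (k : int) : Zpq := << (<< 1 *g k >> : laurent int) *g 0 >>.
Definition Zpq_q (k : int) : Zpq := << 1 *g k >>.

Definition ideal2 (R : comNzRingType) (u v : R) : R -> bool :=
  fun x => `[< exists a b, x = a * u + b * v >].

Lemma ideal2P (R : comNzRingType) (u v : R) :
  1 \notin ideal2 u v -> idealr_closed (ideal2 u v).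
Proof.
move=> I1; split=> //.
  by apply/asboolP; exists 0, 0; rewrite !mul0r addr0.
move=> a x y /asboolP[a1 [b1 ->]] /asboolP[a2 [b2 ->]]; apply/asboolP.
exists (a * a1 + a2), (a * b1 + b2).
by rewrite mulrDr !mulrDl !mulrA addrACA.
Qed.

Definition T_ideal : Zpq -> bool :=
  let p := Zpq_p 1 in let q := Zpq_q 1 in
  ideal2 ((p - 1) * (p - q)) ((q - 1) * (p - q)).

Lemma Zpq_at1_pq (x : Zpq) :
  laurent_at1 (laurent_at1 (x * (Zpq_p 1 - Zpq_q 1))) = 0.
Proof.
rewrite laurent_at1M laurent_at1M.
suff -> : laurent_at1 (laurent_at1 (Zpq_p 1 - Zpq_q 1)) = 0 by exact: mulr0.
apply: (@addIr _ (laurent_at1 (laurent_at1 (Zpq_q 1)))).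
rewrite -laurent_at1D -laurent_at1D addrNK add0r.
by rewrite /Zpq_p /Zpq_q laurent_at1U laurent_at1U laurent_at1U laurent_at1U.
Qed.

Lemma T_ideal1 : 1 \notin T_ideal.
Proof.
apply/asboolPn => -[a [b]].
move/(congr1 (fun x : Zpq => laurent_at1 (laurent_at1 x))).
rewrite [a * _]mulrA [b * _]mulrA laurent_at1D laurent_at1D.
rewrite Zpq_at1_pq Zpq_at1_pq addr0.
by rewrite laurent_at1U laurent_at1U.
Qed.

HB.instance Definition _ := isIdealr.Build Zpq T_ideal (ideal2P T_ideal1).

Definition T : comNzRingType := {ideal_quot (T_ideal : idealr Zpq)}.

(* p^k and q^k in T, for k in Z. *)
Definition p_ (k : int) : T := (\pi_T (Zpq_p k))%qT.
Definition q_ (k : int) : T := (\pi_T (Zpq_q k))%qT.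

Lemma T_pi1 : (\pi_T (1 : Zpq))%qT = 1.
Proof. exact: (rmorph1 (\pi_({ideal_quot (T_ideal : idealr Zpq)})%qT)). Qed.

Lemma T_piM (x y : Zpq) : (\pi_T (x * y))%qT = (\pi_T x)%qT * (\pi_T y)%qT.
Proof. exact: (rmorphM (\pi_({ideal_quot (T_ideal : idealr Zpq)})%qT)). Qed.

Lemma T_piB (x y : Zpq) : (\pi_T (x - y))%qT = (\pi_T x)%qT - (\pi_T y)%qT.
Proof. exact: (rmorphB (\pi_({ideal_quot (T_ideal : idealr Zpq)})%qT)). Qed.

Lemma p_0 : p_ 0 = 1. Proof. exact: T_pi1. Qed.

Lemma q_0 : q_ 0 = 1. Proof. exact: T_pi1. Qed.

Lemma p_D k l : p_ (k + l) = p_ k * p_ l.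
Proof.
rewrite /p_ -T_piM; congr (\pi_T _)%qT.
by rewrite [RHS]laurent_mulUU addr0; congr (<< _ *g 0 >>);
  rewrite [RHS]laurent_mulUU mulr1.
Qed.

Lemma q_D k l : q_ (k + l) = q_ k * q_ l.
Proof.
rewrite /q_ -T_piM; congr (\pi_T _)%qT.
by rewrite [RHS]laurent_mulUU mulr1.
Qed.

Lemma T_piE (x y : Zpq) :
  ((\pi_T x)%qT == (\pi_T y)%qT) = (x - y \in T_ideal).
Proof. by rewrite [RHS]Quotient.idealrBE. Qed.

Lemma T_rel_p : (p_ 1 - 1) * (p_ 1 - q_ 1) = 0.
Proof.
rewrite -p_0 /p_ /q_ -!T_piB -T_piM -(subrr (\pi_T (0 : Zpq))%qT) -T_piB.
apply/eqP; rewrite T_piE !subr0; apply/asboolP; exists 1, 0.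
by rewrite mul1r mul0r addr0.
Qed.

Lemma T_rel_q : (q_ 1 - 1) * (p_ 1 - q_ 1) = 0.
Proof.
rewrite -q_0 /p_ /q_ -!T_piB -T_piM -(subrr (\pi_T (0 : Zpq))%qT) -T_piB.
apply/eqP; rewrite T_piE !subr0; apply/asboolP; exists 0, 1.
by rewrite mul1r mul0r add0r.
Qed.

(******************************************************************************)
(* Long virtual knot diagrams, up to planar isotopy.                          *)
(*                                                                            *)
(* Travelling along the diagram by increasing t, one goes through every       *)
(* crossing (classical or virtual) twice; the diagram is encoded by the word  *)
(* of these passages.  A passage records the name of the crossing, whether    *)
(* the traveller is on the overpass, on the underpass or at a virtual         *)
(* crossing, and whether it goes from the left to the right of the other      *)
(* (oriented) strand.  The plane with the line through infinity being a       *)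
(* 4-valent graph on the sphere with one marked point, this word determines   *)
(* the diagram up to planar isotopy, and a word comes from a diagram iff it   *)
(* is [well_formed] and [planar] (the surface it defines is a sphere).        *)
(* Crossing names carry no information, see [Renaming] below.                 *)
(******************************************************************************)

Local Close Scope ring_scope.

Inductive level := Over | Under | Virtual.

Definition level_code l : option bool :=
  match l with Over => Some true | Under => Some false | Virtual => None end.
Definition level_decode (o : option bool) :=
  match o with Some true => Over | Some false => Under | None => Virtual end.
Lemma level_codeK : cancel level_code level_decode.
Proof. by case. Qed.
HB.instance Definition _ := Equality.copy level (can_type level_codeK).

Record passage := Passage { crossing : nat; lev : level; l2r : bool }.

Definition passage_code a := (crossing a, lev a, l2r a).
Definition passage_decode (x : nat * level * bool) :=
  Passage x.1.1 x.1.2 x.2.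
Lemma passage_codeK : cancel passage_code passage_decode.
Proof. by case. Qed.
HB.instance Definition _ := Equality.copy passage (can_type passage_codeK).

Definition word := seq passage.

(* The passage of the other strand through the same crossing. *)
Definition mate (a : passage) : passage :=
  Passage (crossing a)
    match lev a with Over => Under | Under => Over | Virtual => Virtual end
    (~~ l2r a).

Definition well_formed (w : word) : bool :=
  all (fun a => (mate a \in w) &&
         (count (fun b => crossing b == crossing a) w == 2)) w.

(* The passages of w cut the line into edges 0, ..., size w, edge k being     *)
(* followed by the k-th passage (counting from 0).  (k, true) is the left     *)
(* side of edge k and (k, false) its right side.  [corners w a] lists the     *)
(* four corners at the crossing of a as pairs of sides bounding the same      *)
(* region: think of a as going east, and mate a as going north.               *)
Definition side := (nat * bool)%type.

Definition corners (w : word) (a : passage) : seq (side * side) :=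
  if l2r a then
    let i := index a w in let j := index (mate a) w in
    [:: ((i.+1, true), (j.+1, false));   (* north-east *)
        ((i, true), (j.+1, true));       (* north-west *)
        ((i, false), (j, true));         (* south-west *)
        ((i.+1, false), (j, false))]     (* south-east *)
  else [::].

(* The first and the last edge meet at infinity. *)
Definition all_corners (w : word) : seq (side * side) :=
  [:: ((0, true), (size w, true)); ((0, false), (size w, false))]
  ++ flatten (map (corners w) w).

Definition same_corner (w : word) : rel ('I_(size w).+1 * bool) := fun x y =>
  let x' := (nat_of_ord x.1, x.2) in let y' := (nat_of_ord y.1, y.2) in
  ((x', y') \in all_corners w) || ((y', x') \in all_corners w).

Definition regions (w : word) : nat := n_comp (@same_corner w) predT.

(* Euler's formula V - E + F = 2, with V = (number of crossings) + 1 because  *)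
(* of the point at infinity, and E = (size w) + 1.                            *)
Definition planar (w : word) : bool := regions w == (size w)./2 + 2.

Record diagram := Diagram {
  passages :> word;
  _ : well_formed passages;
  _ : planar passages }.

(******************************************************************************)
(* Generalized Reidemeister moves.                                            *)
(******************************************************************************)

(* [ordered f a b] is the two-letter subword consisting of a and b, with a    *)
(* first iff f.                                                               *)
Definition ordered (f : bool) (a b : passage) : word :=
  if f then [:: a; b] else [:: b; a].

(* A third move involves three strands 1, 2, 3 (numbered in the order of      *)
(* travel) crossing each other pairwise; x, y, z are the passages of 1 across *)
(* 2, of 2 across 3, of 3 across 1, so that mate z, mate x, mate y are those  *)
(* of 1 across 3, of 2 across 1, of 3 across 2.  The bit f_i says that strand *)
(* i meets strand i + 1 (cyclically) before strand i - 1.                     *)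
Definition third_word (u0 u1 u2 u3 : word) (x y z : passage)
    (f1 f2 f3 : bool) : word :=
  u0 ++ ordered f1 x (mate z) ++ u1 ++ ordered f2 y (mate x) ++
  u2 ++ ordered f3 z (mate y) ++ u3.

(* The three segments bound a triangle: each of them has the triangle on the  *)
(* same side at both of its ends.  At the crossing of strands i and j, the    *)
(* segment of j lies to the right of i iff [j goes from the left to the right *)
(* of i] differs from [j meets i at the end of its segment].                  *)
Definition triangle (x y z : passage) (f1 f2 f3 : bool) : bool :=
  [&& l2r (mate x) (+) f2 == l2r z (+) ~~ f3,
      l2r (mate y) (+) f3 == l2r x (+) ~~ f1
    & l2r (mate z) (+) f1 == l2r y (+) ~~ f2].

Definition num_virtual (x y z : passage) : nat :=
  count (fun a => lev a == Virtual) [:: x; y; z].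

(* With three classical crossings, one strand is over the two others and one  *)
(* is under the two others, i.e. the strands are not cyclically layered.      *)
Definition layered (x y z : passage) : bool :=
  ~~ ((lev x == lev y) && (lev y == lev z)).

Inductive move : word -> word -> Prop :=
| Renaming (h : nat -> nat) (w : word) : injective h ->
    move w [seq Passage (h (crossing a)) (lev a) (l2r a) | a <- w]
(* first move, classical or purely virtual *)
| Omega1 (u v : word) (a : passage) :
    move (u ++ v) (u ++ [:: a; mate a] ++ v)
(* second move, classical or purely virtual, the second strand being parallel *)
(* or antiparallel to the first                                               *)
| Omega2 (u v w : word) (a b : passage) (parallel : bool) :
    lev a = lev b -> l2r b = ~~ l2r a ->
    move (u ++ v ++ w)
         (u ++ [:: a; b] ++ v ++ ordered parallel (mate a) (mate b) ++ w)
(* third move: classical *)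
| Omega3 (u0 u1 u2 u3 : word) (x y z : passage) (f1 f2 f3 : bool) :
    triangle x y z f1 f2 f3 -> num_virtual x y z = 0 -> layered x y z ->
    move (third_word u0 u1 u2 u3 x y z f1 f2 f3)
         (third_word u0 u1 u2 u3 x y z (~~ f1) (~~ f2) (~~ f3))
(* third move: purely virtual *)
| Omega3_virtual (u0 u1 u2 u3 : word) (x y z : passage) (f1 f2 f3 : bool) :
    triangle x y z f1 f2 f3 -> num_virtual x y z = 3 ->
    move (third_word u0 u1 u2 u3 x y z f1 f2 f3)
         (third_word u0 u1 u2 u3 x y z (~~ f1) (~~ f2) (~~ f3))
(* third move: semivirtual *)
| Omega3_semivirtual (u0 u1 u2 u3 : word) (x y z : passage) (f1 f2 f3 : bool) :
    triangle x y z f1 f2 f3 -> num_virtual x y z = 2 ->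
    move (third_word u0 u1 u2 u3 x y z f1 f2 f3)
         (third_word u0 u1 u2 u3 x y z (~~ f1) (~~ f2) (~~ f3)).

(* All intermediate words are required to be diagrams, i.e. planar. *)
Definition equivalent : diagram -> diagram -> Prop :=
  clos_refl_sym_trans diagram (fun D D' => move D D').

(******************************************************************************)
(* Arcs, degrees and incidence coefficients.                                  *)
(******************************************************************************)

Local Open Scope ring_scope.

Section Zeta.
Variable D : word.

(* The classical crossings, numbered by the order of their underpasses; see   *)
(* [zeta_numbering] for the independence of the numbering.                    *)
Definition classical_crossings : seq nat :=
  [seq crossing a | a <- D & lev a == Under].

(* The diagram is broken at underpasses and virtual crossings, so arc k, for  *)
(* k = 0, ..., size arc_ends, comes after exactly k letters of [arc_ends].    *)
Definition breaks (a : passage) : bool := lev a != Over.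
Definition arc_ends : word := filter breaks D.
Definition arc := 'I_(size arc_ends).+1.

(* The arc containing edge k. *)
Definition arc_of_edge (k : nat) : nat := count breaks (take k D).

(* Long arcs are broken at underpasses only; the first one (gamma_-) and the  *)
(* last one (gamma_+) are identified.                                         *)
Definition long_arc (k : nat) : nat :=
  (count (fun a => lev a == Under) (take k arc_ends)
     %% size classical_crossings)%N.

(* The degree after the letter a, if it is d before; a long arc starts after  *)
(* an underpass.                                                              *)
Definition degree_step (d : int) (a : passage) : int :=
  match lev a with
  | Over => d
  | Under => 0
  | Virtual => if l2r a then d + 1 else d - 1
  end.

(* The degree of the last arc of gamma_+, which is also that of the first arc *)
(* of gamma_-; if there is a classical crossing, this does not depend on the  *)
(* initial value 0.                                                           *)
Definition last_degree : int := foldl degree_step 0 arc_ends.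

Definition degree (k : nat) : int :=
  foldl degree_step last_degree (take k arc_ends).

Definition over_position (v : nat) : nat :=
  find (fun a => (crossing a == v) && (lev a == Over)) D.
Definition under_position (v : nat) : nat :=
  find (fun a => (crossing a == v) && (lev a == Under)) D.

Definition comes_into (k v : nat) : bool :=
  k == arc_of_edge (under_position v).
Definition emanates_from (k v : nat) : bool :=
  k == arc_of_edge (under_position v).+1.
Definition passes_over (k v : nat) : bool :=
  k == arc_of_edge (over_position v).

(* A crossing is positive iff the direction of its overpass followed by that  *)
(* of its underpass is a positive frame, i.e. iff the overpass goes from the  *)
(* left to the right of the underpass.                                        *)
Definition writhe (v : nat) : int :=
  if Passage v Over true \in D then 1 else -1.

Definition early_over (v : nat) : bool := (over_position v < under_position v)%N.

(* t ^ (sgn v), where t = p or q. *)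
Definition t_sgn (v : nat) : T :=
  if early_over v then p_ (writhe v) else q_ (writhe v).

Definition incidence (v k : nat) : T :=
  (emanates_from k v)%:R * 1 + (passes_over k v)%:R * (t_sgn v - 1)
  + (comes_into k v)%:R * (- t_sgn v).

(* The long arc emanating from v. *)
Definition emanating_long_arc (v : nat) : nat :=
  long_arc (arc_of_edge (under_position v).+1).

(* << c *g d >> is c s^d. *)
Definition zeta_entry (v w : nat) : laurent T :=
  \sum_(a : arc | long_arc a == emanating_long_arc w)
     << incidence v a *g degree a >>.

Definition zeta_matrix (vs : seq nat) : 'M[laurent T]_(size vs) :=
  \matrix_(i, j) zeta_entry (nth 0%N vs i) (nth 0%N vs j).

Definition zeta : laurent T := \det (zeta_matrix classical_crossings).

Lemma zeta_numbering (vs : seq nat) :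
  perm_eq vs classical_crossings -> \det (zeta_matrix vs) = zeta.
Proof.
rewrite /zeta /zeta_matrix; move: classical_crossings => us vsE.
pose M n (ts : seq nat) : 'M[laurent T]_n :=
  \matrix_(i, j) zeta_entry (nth 0%N ts i) (nth 0%N ts j).
have -> : \det (M (size vs) vs) = \det (M (size us) vs).
  by rewrite (perm_size vsE).
have : perm_eq vs (in_tuple us) by [].
case/tuple_permP => s vs_s.
have -> : M (size us) vs = row_perm s (col_perm s (M (size us) us)).
  apply/matrixP => i j; rewrite !mxE.
  have nthE (k : 'I_(size us)) : nth 0%N vs k = nth 0%N us (s k).
    rewrite vs_s -[k in LHS](tnth_ord_tuple k) /=.
    by rewrite (nth_map k) ?size_enum_ord // (tnth_nth 0%N) /=
      tnth_ord_tuple nth_ord_enum.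
  by rewrite !nthE.
rewrite row_permE col_permE !det_mulmx !det_perm odd_permV.
by rewrite mulrC -mulrA -expr2 sqrr_sign mulr1.
Qed.

End Zeta.

(* Main.v *)
(** Label the stretches of the diagram between consecutive passages ("edges",
    numbered 0, ..., N along the line) by unknowns.  Every passage gives one
    linear relation for the edge leaving it: e' = e at an overpass,
    e' = s^{+-1} e at a virtual crossing, and e' = t e + (1 - t) o at an
    underpass, o being the edge entering the overpass; closing up the line adds
    e_0 = e_N.  Eliminating all edges that do not leave an underpass turns this
    square system into the matrix of zeta, so zeta is its determinant.  The
    large determinant makes sense without classical crossings as well, and
    every move changes only a few relations.  Solving for the edges
    inside the move shows that it is unchanged, up to a factor q^{+-1} coming
    from a first move that meets its underpass first.  The third move amounts
    to (1 - t1) (t2 - t3) = 0 for t1, t2, t3 among the powers p^{+-1}, q^{+-1},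
    with equal exponents in t2 and t3: these are the relations defining T. *)

Require Import Defs.
From mathcomp Require Import all_boot all_fingroup all_algebra.
From mathcomp Require Import monalg.
From mathcomp Require Import zify ring.

Set Implicit Arguments.
Unset Strict Implicit.
Unset Printing Implicit Defensive.

Import GRing.Theory.
Local Open Scope ring_scope.

(** * Determinants indexed by labels *)

Section LabelledDet.
Variable R : comNzRingType.
Implicit Types (M E : nat -> nat -> R) (s U V : seq nat).

(** Rows and columns are named by natural numbers listed in any order, so that unknowns can be
    reordered and split into blocks while keeping their names. *)
Definition label_mx M m n s s' : 'M[R]_(m, n) :=
  \matrix_(i, j) M (nth 0%N s i) (nth 0%N s' j).

Definition label_det s M : R := \det (label_mx M (size s) (size s) s s).

Lemma eq_label_det s M M' :
  {in s &, M =2 M'} -> label_det s M = label_det s M'.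
Proof.
move=> eqM; congr (\det _); apply/matrixP => i j; rewrite !mxE.
by apply: eqM; apply: mem_nth.
Qed.

Lemma label_det_map (f : nat -> nat) s M :
  label_det (map f s) M = label_det s (fun x y => M (f x) (f y)).
Proof.
rewrite /label_det size_map; congr (\det _); apply/matrixP => i j.
by rewrite !mxE !(nth_map 0%N).
Qed.

(** The same permutation acts on rows and columns, so its sign appears squared. *)
Lemma label_det_perm s s' M :
  perm_eq s s' -> label_det s M = label_det s' M.
Proof.
move=> ss'; rewrite /label_det (perm_size ss').
have /tuple_permP[p s_p] : perm_eq s (in_tuple s') by [].
have nthE (k : 'I_(size s')) : nth 0%N s k = nth 0%N s' (p k).
  rewrite s_p -[k in LHS](tnth_ord_tuple k) /=.
  by rewrite (nth_map k) ?size_enum_ord // (tnth_nth 0%N) /=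
    tnth_ord_tuple nth_ord_enum.
have -> : label_mx M (size s') (size s') s s =
  row_perm p (col_perm p (label_mx M (size s') (size s') s' s')).
  by apply/matrixP => i j; rewrite !mxE !nthE.
rewrite row_permE col_permE !det_mulmx !det_perm odd_permV.
by rewrite mulrC -mulrA -expr2 sqrr_sign mulr1.
Qed.

Lemma label_det_trig s M :
  (forall i j, (i < j < size s)%N -> M (nth 0%N s i) (nth 0%N s j) = 0) ->
  {in s, forall x, M x x = 1} -> label_det s M = 1.
Proof.
move=> M0 M1; rewrite /label_det det_trig.
  by apply: big1 => i _; rewrite !mxE M1 // mem_nth.
apply/is_trig_mxP => i j ij; rewrite mxE M0 //.
by rewrite ij ltn_ord.
Qed.

Lemma label_det2 x y M :
  label_det [:: x; y] M = M x x * M y y - M x y * M y x.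
Proof. rewrite /label_det (expand_det_row _ ord0) !big_ord_recl big_ord0.
rewrite /cofactor !det_mx11 !mxE /=; ring. Qed.

(* E expresses the unknowns in terms of those in U; multiplying on the right by
   [1, E; 0, 1] makes the matrix block triangular. *)
Lemma label_det_peel V U M E : uniq U ->
  {in U &, forall x z, E x z = (x == z)%:R} ->
  {in V & U, forall x z, \sum_(y <- V ++ U) M x y * E y z = 0} ->
  label_det (V ++ U) M = label_det V M *
    label_det U (fun x z => \sum_(y <- V ++ U) M x y * E y z).
Proof.
move=> uU EU MV; set M' := fun x z => _.
pose v := size V; pose u := size U.
have -> : label_det (V ++ U) M =
    \det (label_mx M (v + u) (v + u) (V ++ U) (V ++ U)).
  by rewrite /label_det size_cat.
have vE (i : 'I_v) : nth 0%N (V ++ U) (lshift u i) = nth 0%N V i.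
  by rewrite nth_cat /= ltn_ord.
have uE (i : 'I_u) : nth 0%N (V ++ U) (rshift v i) = nth 0%N U i.
  by rewrite nth_cat /= ltnNge leq_addr /= addKn.
have -> : label_mx M (v + u) (v + u) (V ++ U) (V ++ U) =
  block_mx (label_mx M v v V V) (label_mx M v u V U)
           (label_mx M u v U V) (label_mx M u u U U).
  rewrite -[LHS]submxK; congr block_mx; apply/matrixP => i j;
  by rewrite !mxE ?vE ?uE.
set B := block_mx _ _ _ _.
pose E' := block_mx (1%:M : 'M_v) (label_mx E v u V U) 0 1%:M.
have E1 : label_mx E u u U U = 1%:M.
  by apply/matrixP => i j; rewrite !mxE EU ?mem_nth ?nth_uniq.
have M'E n s : (label_mx M n v s V *m label_mx E v u V U +
    label_mx M n u s U) = label_mx M' n u s U.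
  rewrite -[X in _ + X]mulmx1 -E1; apply/matrixP => i j.
  rewrite !mxE /M' big_cat /= (big_nth 0%N) big_mkord.
  rewrite [X in _ = _ + X](big_nth 0%N) big_mkord.
  by congr (_ + _); apply: eq_bigr => k _; rewrite !mxE.
have V0 : label_mx M' v u V U = 0.
  by apply/matrixP => i j; rewrite !mxE /M' MV ?mem_nth.
rewrite -[LHS]mulr1 -(_ : \det E' = 1); last first.
  by rewrite det_ublock !det1 mulr1.
rewrite -det_mulmx mulmx_block !mulmx1 !mulmx0 !addr0 !M'E V0.
by rewrite det_lblock.
Qed.

(** Serves for the block of the four edges inserted by a second move. Column [z] vanishes outside
    its own row, so after elimination of [y] and [z] only [y] contributes corrections. *)
Lemma label_det4 (w x y z : nat) M : uniq [:: y; z; w; x] ->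
  M y y = 1 -> M z z = 1 -> M y z = 0 -> M w z = 0 -> M x z = 0 ->
  label_det [:: y; z; w; x] M =
    (M w w - M w y * M y w) * (M x x - M x y * M y x) -
    (M w x - M w y * M y x) * (M x w - M x y * M y w).
Proof.
move=> uL yy zz yz wz xz.
have nE (a b : nat) : a != b -> ((a == b) = false) * ((b == a) = false).
  by move=> ab; split; [|rewrite eq_sym]; apply: negPf.
have [[yz' yw yx] [zw zx] wx] : [/\ [/\ y != z, y != w & y != x],
    z != w /\ z != x & w != x].
  by move: uL; rewrite /= !inE !negb_or -!andbA => /and5P[-> -> -> -> /andP[-> /andP[->]]].
(* The rows of [y] and [z] solved for these unknowns, [y] first because its row does not contain
   [z]. *)
pose E a b := if a == y then - M y b else
  if a == z then M z y * M y b - M z b else (a == b)%:R.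
rewrite (@label_det_peel [:: y; z] [:: w; x] _ E).
- rewrite !label_det2 !big_cons !big_nil /E !eqxx !(nE _ _ yz', nE _ _ yw, nE _ _ yx,
    nE _ _ zw, nE _ _ zx, nE _ _ wx) yy zz yz wz xz /=; ring.
- by rewrite /= inE wx.
- by move=> a b; rewrite !inE /E => /orP[] /eqP -> _;
    rewrite !(nE _ _ yw, nE _ _ yx, nE _ _ zw, nE _ _ zx).
- move=> a b; rewrite !inE => /orP[] /eqP -> /orP[] /eqP ->;
  rewrite !big_cons !big_nil /E !eqxx !(nE _ _ yz', nE _ _ yw, nE _ _ yx,
    nE _ _ zw, nE _ _ zx, nE _ _ wx) ?yy ?zz ?yz /=; ring.
Qed.

Section SparseSystem.
Variables (C G : nat -> R) (P Q : nat -> nat).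

(* Row x is the relation e_x = C x * e_(P x) + G x * e_(Q x). *)
Definition sparse x y : R :=
  (x == y)%:R - C x * (P x == y)%:R - G x * (Q x == y)%:R.

Lemma sum_sparse s E x z : uniq s -> x \in s -> P x \in s -> Q x \in s ->
  \sum_(y <- s) sparse x y * E y z = E x z - C x * E (P x) z - G x * E (Q x) z.
Proof.
move=> us xs Ps Qs.
have sumd a : a \in s -> \sum_(y <- s) (a == y)%:R * E y z = E a z.
  move=> as_; rewrite (bigD1_seq a) //= eqxx mul1r big1 ?addr0 // => y ya.
  by rewrite eq_sym (negPf ya) mul0r.
rewrite -(sumd x xs) -(sumd _ Ps) -(sumd _ Qs) !mulr_sumr -!sumrB.
by apply: eq_bigr => y _; rewrite /sparse !mulrBl !mulrA.
Qed.

Lemma sparse_peel V U E : uniq (V ++ U) ->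
  {in V ++ U, forall x, (P x \in V ++ U) && (Q x \in V ++ U)} ->
  {in U &, forall x z, E x z = (x == z)%:R} ->
  {in V & U, forall x z, E x z = C x * E (P x) z + G x * E (Q x) z} ->
  label_det (V ++ U) sparse = label_det V sparse *
    label_det U (fun x z => E x z - C x * E (P x) z - G x * E (Q x) z).
Proof.
move=> uVU PQ EU EV.
rewrite (@label_det_peel _ _ _ E) //.
- congr (_ * _); apply: eq_label_det => x z xU zU.
  have xVU : x \in V ++ U by rewrite mem_cat xU orbT.
  by have /andP[] := PQ _ xVU; move=> *; rewrite sum_sparse.
- by move: uVU; rewrite cat_uniq => /and3P[].
- move=> x z xV zU.
  have xVU : x \in V ++ U by rewrite mem_cat xV.
  have /andP[PV QV] := PQ _ xVU; rewrite sum_sparse // EV //; ring.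
Qed.
End SparseSystem.
End LabelledDet.

(** * The system of edges *)

Lemma mateK : involutive mate.
Proof. by case=> c l b; rewrite /mate /= negbK; case: l. Qed.

Lemma mate_neq a : mate a != a.
Proof. by case: a => c l b; apply/eqP => -[_ /eqP]; case: b. Qed.

(** * Mates and positions in a well-formed word *)

Section WellFormed.
Variable w : word.
Hypothesis wf : well_formed w.

Lemma mem_mate a : a \in w -> mate a \in w.
Proof. by move=> aw; have /andP[] := allP wf a aw. Qed.

Lemma count_crossing a : a \in w ->
  count (fun b => crossing b == crossing a) w = 2.
Proof. by move=> aw; have /andP[_ /eqP] := allP wf a aw. Qed.

Lemma count_pair (a b : passage) : a != b -> crossing a = crossing b ->
  (count_mem a w + count_mem b w <= count (fun c => crossing c == crossing a) w)%N.
Proof.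
move=> ab cab; rewrite -(count_predUI (pred1 a) (pred1 b)).
rewrite [X in (_ + X)%N](@eq_count _ _ pred0) ?count_pred0 ?addn0.
  by apply: sub_count => x /= /orP[] /eqP -> //; rewrite cab.
by move=> x /=; apply/andP => -[/eqP -> /eqP]; apply/eqP.
Qed.

(** A letter and its mate are distinct and share a crossing, which is met exactly twice, so each
    occurs once. Letters can thus be located by [index]. *)
Lemma well_formed_uniq : uniq w.
Proof.
apply: count_mem_uniq => a; case: (boolP (a \in w)) => aw; last first.
  exact/count_memPn.
have := @count_pair _ _ (mate_neq a) erefl.
rewrite count_crossing ?mem_mate //.
have: (0 < count_mem (mate a) w)%N by rewrite -has_count has_pred1 mem_mate.
have: (0 < count_mem a w)%N by rewrite -has_count has_pred1.
by rewrite /=; lia.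
Qed.

Lemma same_crossing a b : a \in w -> b \in w -> crossing b = crossing a ->
  b = a \/ b = mate a.
Proof.
move=> aw bw cab; case: (eqVneq b a) => [|ba]; [by left|right].
apply/eqP; apply: contraT => bma.
suff: (3 <= count (fun c => crossing c == crossing a) w)%N.
  by rewrite count_crossing.
have -> : 3%N = size [:: a; mate a; b] by [].
rewrite -size_filter; apply: uniq_leq_size.
  by rewrite /= !inE !negb_or [a == _]eq_sym mate_neq [a == b]eq_sym ba eq_sym bma.
by move=> c; rewrite !inE mem_filter => /or3P[] /eqP ->;
  rewrite ?cab eqxx ?mem_mate.
Qed.

End WellFormed.

(** * The relations between the edges *)

Definition letter (w : word) k := nth (Passage 0 Over true) w k.

Arguments letter : simpl never.

(** This is [t_sgn] read off the letter of an underpass: an underpass going from the left to the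
    right of its overpass belongs to a negative crossing, and [p] is chosen when the overpass comes
    first. *)
Definition under_coef (w : word) (a : passage) : T :=
  let e : int := if l2r a then -1 else 1 in
  if (index (mate a) w < index a w)%N then p_ e else q_ e.

Definition passage_coef (w : word) (a : passage) : laurent T :=
  match lev a with
  | Over => 1
  | Under => << under_coef w a *g 0 >>
  | Virtual => << 1 *g if l2r a then 1 else -1 >>
  end.

Definition over_coef (w : word) (a : passage) : laurent T :=
  if lev a == Under then 1 - passage_coef w a else 0.

Section EdgeSystem.
Variable w : word.

(** Passage [k] is entered by edge [k] and left by edge [k.+1], which names its relation; hence
    [edge_Q] is the edge entering the mate. Relation 0 closes up the line by equating edge 0 with
    the last edge. *)
Definition edge_C x := if x is k.+1 then passage_coef w (letter w k) else 1.
Definition edge_G x := if x is k.+1 then over_coef w (letter w k) else 0.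
Definition edge_P x := if x is k.+1 then k else size w.
Definition edge_Q x :=
  if x is k.+1 then index (mate (letter w k)) w else 0%N.

Definition edge_system := sparse edge_C edge_G edge_P edge_Q.
Definition edges := iota 0 (size w).+1.
Definition edge_det := label_det edges edge_system.

Lemma mem_edges x : (x \in edges) = (x <= size w)%N.
Proof. by rewrite mem_iota add0n ltnS. Qed.

Lemma edge_PQ (wf : well_formed w) :
  {in edges, forall x, (edge_P x \in edges) && (edge_Q x \in edges)}.
Proof.
move=> [|k]; rewrite !mem_edges /= ?leqnn // => kw.
by rewrite ltnW //= ltnW // index_mem mem_mate // mem_nth.
Qed.
End EdgeSystem.

(** * Insertion of one or two words into a word *)

Section Insertion.
Variables u A v B w : word.
Let w0 := u ++ v ++ w.
Let w1 := u ++ A ++ v ++ B ++ w.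
Hypotheses (wf0 : well_formed w0) (wf1 : well_formed w1).
Let i := size u.
Let j := (size u + size v)%N.

Definition new_letter k :=
  (k + (if k < i then 0 else if k < j then size A else size A + size B))%N.
(* An edge in which a word is inserted gives its name to the part preceding the
   inserted word. *)
Definition new_edge k :=
  (k + (if k <= i then 0 else if k <= j then size A else size A + size B))%N.
Definition inserted := iota i.+1 (size A) ++ iota (j + size A).+1 (size B).

Lemma new_edgeS k : new_edge k.+1 = (new_letter k).+1.
Proof. by rewrite /new_edge /new_letter addSn. Qed.

Lemma size_w1 : size w1 = new_letter (size w0).
Proof. by rewrite /new_letter /w1 /w0 !size_cat /i /j; case: ifP; [|case: ifP]; lia. Qed.

Lemma new_edge_inj : injective new_edge.
Proof.
by move=> x y; rewrite /new_edge; do ![case: ifP]; lia.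
Qed.

Lemma new_edge_notin k : new_edge k \notin inserted.
Proof.
clear wf0 wf1; rewrite /inserted mem_cat !mem_iota /new_edge /j -/i.
by do ![case: ifP]; lia.
Qed.

Lemma new_letter_lt x y : (new_letter x < new_letter y)%N = (x < y)%N.
Proof.
by rewrite /new_letter; do ![case: ifP]; lia.
Qed.

Lemma letter_w1 k : (k < size w0)%N -> letter w1 (new_letter k) = letter w0 k.
Proof.
rewrite /letter /new_letter /w1 /w0 !size_cat !nth_cat -/i /j => kw.
case: (ltnP k i) => ki; first by rewrite addn0 ki.
case: (ltnP k (i + size v)) => kj.
  have -> : (k + size A < i)%N = false by lia.
  have -> : (k + size A - i < size A)%N = false by lia.
  have -> : (k + size A - i - size A < size v)%N by lia.
  have -> : (k - i < size v)%N by lia.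
  by congr nth; lia.
have -> : (k + (size A + size B) < i)%N = false by lia.
have -> : (k + (size A + size B) - i < size A)%N = false by lia.
have -> : (k + (size A + size B) - i - size A < size v)%N = false by lia.
have -> : (k + (size A + size B) - i - size A - size v < size B)%N = false by lia.
have -> : (k - i < size v)%N = false by lia.
by congr nth; lia.
Qed.

Lemma index_w1 a : a \in w0 -> index a w1 = new_letter (index a w0).
Proof.
move=> aw; have lt_a : (index a w0 < size w0)%N by rewrite index_mem.
rewrite -{1}(nth_index (Passage 0 Over true) aw) -/(letter _ _).
rewrite -letter_w1 // index_uniq ?well_formed_uniq //.
by rewrite size_w1 new_letter_lt.
Qed.

(** Insertion keeps the order of the old letters, hence also which passage of a crossing comes
    first. *)
Lemma passage_coef_w1 a : a \in w0 -> passage_coef w1 a = passage_coef w0 a.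
Proof.
move=> aw; rewrite /passage_coef /under_coef.
by rewrite !index_w1 ?mem_mate // new_letter_lt.
Qed.

Lemma edges_w1 :
  perm_eq (edges w1) (inserted ++ map new_edge (edges w0)).
Proof.
have mapE m n d : (forall k, (m <= k < m + n)%N -> new_edge k = (k + d)%N) ->
    map new_edge (iota m n) = iota (m + d) n.
  move=> newE; rewrite addnC iotaDl; apply/eq_in_map => k.
  by rewrite mem_iota => /newE ->; rewrite addnC.
have -> : edges w0 = iota 0 i.+1 ++ iota i.+1 (size v) ++ iota j.+1 (size w).
  rewrite /edges -[iota j.+1 _]/(iota (i + size v).+1 _) -addSn -iotaD.
  rewrite -{2}[i.+1]add0n -iotaD.
  by congr iota; rewrite /w0 !size_cat /i; lia.
have -> : edges w1 = iota 0 i.+1 ++ iota i.+1 (size A) ++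
    iota (i.+1 + size A) (size v) ++ iota (i.+1 + size A + size v) (size B) ++
    iota (i.+1 + size A + size v + size B) (size w).
  rewrite -!iotaD.
  by congr iota; rewrite /w1 !size_cat /i; lia.
rewrite !map_cat (mapE 0%N i.+1 0%N); last first.
  by move=> k; rewrite /new_edge; do ![case: ifP]; lia.
rewrite (mapE i.+1 _ (size A)); last first.
  by move=> k; rewrite /new_edge /j; do ![case: ifP]; lia.
rewrite (mapE j.+1 _ (size A + size B)%N); last first.
  by move=> k; rewrite /new_edge /j; do ![case: ifP]; lia.
have -> : (i.+1 + size A + size v)%N = (j + size A).+1 by rewrite /j -/i; lia.
have -> : ((j + size A).+1 + size B)%N = (j.+1 + (size A + size B))%N by lia.
apply/seq.permP => a; rewrite /inserted !count_cat addn0; lia.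
Qed.

(** Applies when the inserted relations have a solution in which each inserted word hands on the
    value of the edge entering it. The old relations then turn into those of [w0], and the block of
    the inserted edges splits off as a factor. *)
Lemma edge_det_insertion (E : nat -> nat -> laurent T) :
  (forall k x, E (new_edge k) x = (new_edge k == x)%:R) ->
  E (i + size A)%N =1 E i ->
  E (j + size A + size B)%N =1 E (new_edge j) ->
  {in inserted, forall x z, E x z =
     edge_C w1 x * E (edge_P w1 x) z + edge_G w1 x * E (edge_Q w1 x) z} ->
  edge_det w1 = label_det inserted (edge_system w1) * edge_det w0.
Proof.
move=> Enew Ei Ej EV.
(* The edge entering an old letter is [new_letter k] in [w1]; it can differ from [new_edge k] only
   if a word is inserted just before that letter, and then [Ei] or [Ej] gives it the right value. *)
have Eletter k x : E (new_letter k) x = (new_edge k == x)%:R.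
  case: (eqVneq k j) => [->|kj].
    have -> : new_letter j = (j + size A + size B)%N.
      by rewrite /new_letter ltnn ltnNge leq_addr addnA.
    by rewrite Ej Enew.
  case: (eqVneq k i) => [ki|ki]; last first.
    have -> : new_letter k = new_edge k.
      by rewrite /new_letter /new_edge; do ![case: ifP]; lia.
    exact: Enew.
  have -> : new_letter k = (i + size A)%N.
    by rewrite ki /new_letter ltnn ltn_neqAle leq_addr andbT -ki kj.
  have -> : new_edge k = i by rewrite ki /new_edge leqnn addn0.
  by rewrite Ei -[i]addn0 -(_ : new_edge i = (i + 0)%N) ?Enew // /new_edge leqnn.
have := edge_PQ wf1; rewrite /edge_det.
rewrite (label_det_perm _ edges_w1).
have := perm_uniq edges_w1; rewrite iota_uniq => /esym uVU PQ.
rewrite (@sparse_peel _ _ _ _ _ _ _ E) //; last first.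
- by move=> x z xV _; apply: EV.
- by move=> _ z /mapP[k _ ->] _; apply: Enew.
- by move=> x; rewrite -!(perm_mem edges_w1); apply: PQ.
congr (_ * _); rewrite label_det_map; apply: eq_label_det => x y.
rewrite mem_edges => xw _; rewrite Enew (inj_eq new_edge_inj) /edge_system /sparse.
case: x xw => [|k] kw.
  rewrite -[edge_P w1 _]/(size w1) size_w1 Eletter (inj_eq new_edge_inj).
  by rewrite /= !mul0r.
have kw0 : letter w0 k \in w0 by rewrite mem_nth.
rewrite new_edgeS /= letter_w1 // Eletter index_w1 ?mem_mate // Eletter.
rewrite !(inj_eq new_edge_inj) /over_coef passage_coef_w1 //.
Qed.
End Insertion.

Lemma letter_cat (s1 : word) x s2 : letter (s1 ++ x :: s2) (size s1) = x.
Proof. by rewrite /letter nth_cat ltnn subnn. Qed.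

Lemma index_letter w k : well_formed w -> (k < size w)%N ->
  index (letter w k) w = k.
Proof. by move=> wf kw; rewrite index_uniq ?well_formed_uniq. Qed.

Lemma over_coef_under w a : lev a = Under -> over_coef w a = 1 - passage_coef w a.
Proof. by rewrite /over_coef => ->. Qed.

Lemma over_coef0 w a : lev a <> Under -> over_coef w a = 0.
Proof. by rewrite /over_coef; case: eqP. Qed.

Lemma passage_coef_over w a : lev a = Over -> passage_coef w a = 1.
Proof. by rewrite /passage_coef => ->. Qed.

Lemma laurent_monoM (R : comNzRingType) (a b : R) (k l : int) :
  (<< a *g k >> : laurent R) * << b *g l >> = << a * b *g k + l >>.
Proof. exact: laurent_mulUU. Qed.

Lemma passage_coef_virtualM w w' a b : lev a = Virtual -> lev b = Virtual ->
  l2r b = ~~ l2r a -> passage_coef w a * passage_coef w' b = 1.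
Proof.
by rewrite /passage_coef => -> -> ->; case: (l2r a); rewrite laurent_monoM mulr1.
Qed.

(** * Elimination of the edges that do not leave an underpass *)

Definition under_at (w : word) k := lev (letter w k) == Under.
Definition under_positions (w : word) := [seq k <- iota 0 (size w) | under_at w k].

Lemma take_filter (S : Type) (p : pred S) e (s : seq S) :
  take (count p (take e s)) (filter p s) = filter p (take e s).
Proof.
by rewrite -{2}(cat_take_drop e s) filter_cat -size_filter take_size_cat.
Qed.

Lemma foldl_degree_step d (s : word) :
  foldl degree_step d (filter breaks s) = foldl degree_step d s.
Proof.
elim: s d => //= a s IH d; rewrite /breaks; case: eqP => la /=; last exact: IH.
by rewrite IH /degree_step la.
Qed.

(** An underpass resets the degree to 0, so the initial degree is forgotten. *)
Lemma foldl_degree_step_under d d' (s : word) :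
  has (fun a => lev a == Under) s ->
  foldl degree_step d s = foldl degree_step d' s.
Proof.
elim: s d d' => //= a s IH d d' /orP[/eqP la|su]; last exact: IH.
by rewrite /degree_step la.
Qed.

Lemma uniq_iota_rot m n : (m <= n)%N -> uniq (iota m (n - m) ++ iota 0 m).
Proof. by move=> mn; rewrite uniq_catC -iotaD iota_uniq. Qed.

Section ZetaEdge.
Variable w : word.
Hypotheses (wf : well_formed w) (classical : (0 < size (classical_crossings w))%N).

Let num_under := size (classical_crossings w).
Let under_count e := count (fun a => lev a == Under) (take e w).
Let edge_degree e := foldl degree_step (last_degree w) (take e w).

Lemma num_underE : num_under = count (fun a => lev a == Under) w.
Proof. by rewrite /num_under size_map size_filter. Qed.

Lemma long_arc_edge e : long_arc w (arc_of_edge w e) = (under_count e %% num_under)%N.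
Proof.
rewrite /long_arc /arc_of_edge /arc_ends take_filter count_filter.
congr (_ %% _)%N; apply: eq_count => a /=.
by rewrite /breaks; case: (lev a).
Qed.

Lemma degree_edge e : degree w (arc_of_edge w e) = edge_degree e.
Proof. by rewrite /degree /arc_of_edge /arc_ends take_filter foldl_degree_step. Qed.

Lemma under_countS k : (k < size w)%N -> under_count k.+1 = (under_count k + under_at w k)%N.
Proof.
by move=> kw; rewrite /under_count (take_nth (Passage 0 Over true)) // -cats1 count_cat /= addn0.
Qed.

Lemma edge_degreeS k : (k < size w)%N ->
  edge_degree k.+1 = degree_step (edge_degree k) (letter w k).
Proof.
by move=> kw; rewrite /edge_degree (take_nth (Passage 0 Over true)) // foldl_rcons.
Qed.

Lemma under_count_mono e e' : (e <= e')%N -> (under_count e <= under_count e')%N.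
Proof.
move=> ee'; rewrite /under_count -(take_takel w ee').
by rewrite -{2}(cat_take_drop e (take e' w)) count_cat leq_addr.
Qed.

Lemma edge_degree_last : edge_degree (size w) = edge_degree 0.
Proof.
rewrite /edge_degree take0 take_size /= /last_degree foldl_degree_step.
by apply: foldl_degree_step_under; rewrite has_count -num_underE.
Qed.

Lemma under_count_last : (under_count (size w) %% num_under = under_count 0 %% num_under)%N.
Proof. by rewrite /under_count take_size -num_underE take0 modnn mod0n. Qed.

(** The edges leaving underpasses have counts 1, ..., [num_under], which are distinct modulo
    [num_under]. The last count becomes 0, the class of the initial long arc: this is the gluing of
    the two ends. *)
Lemma under_count_eq k l : (k < size w)%N -> (l < size w)%N -> under_at w k -> under_at w l ->
  (under_count k.+1 %% num_under == under_count l.+1 %% num_under)%N = (k == l).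
Proof.
move=> kw lw ku lu; apply/eqP/eqP => [|-> //].
have bound j : (j < size w)%N -> under_at w j -> (0 < under_count j.+1 <= num_under)%N.
  move=> jw ju; have := under_count_mono jw.
  rewrite {2}/under_count take_size -num_underE => ->.
  by rewrite under_countS // ju addn1.
have /andP[k0 kn] := bound _ kw ku; have /andP[l0 ln] := bound _ lw lu.
have mod_pred j : (0 < j <= num_under)%N -> (j %% num_under)%N = if j == num_under then 0%N else j.
  case/andP=> j0 jn; case: eqP => [->|jn']; rewrite ?modnn // modn_small //.
  by rewrite ltn_neqAle jn andbT; apply/eqP.
rewrite !mod_pred ?k0 ?l0 // => eqkl.
have {}eqkl : under_count k.+1 = under_count l.+1 by move: eqkl; do 2 case: eqP; lia.
case: (ltngtP k l) => // lt.
  by have := under_count_mono lt; rewrite eqkl under_countS // lu; lia.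
by have := under_count_mono lt; rewrite -eqkl under_countS // ku; lia.
Qed.

Lemma find_index a (p : pred passage) : a \in w -> p a ->
  {in w, forall b, p b -> b = a} -> find p w = index a w.
Proof.
move=> aw pa puniq; rewrite /index; apply: eq_in_find => b bw /=.
by apply/idP/eqP => [|->//]; exact: puniq.
Qed.

Section Under.
Variable k : nat.
Hypotheses (kw : (k < size w)%N) (ku : under_at w k).
Let a := letter w k.

Let aw : a \in w. Proof. exact: mem_nth. Qed.
Let la : lev a = Under. Proof. exact/eqP. Qed.

Lemma under_positionE : under_position w (crossing a) = k.
Proof.
rewrite -[RHS](index_letter wf kw); apply: find_index => //; first by rewrite eqxx la eqxx.
move=> b bw /andP[/eqP bc /eqP bl]; have [//|bE] := same_crossing wf aw bw bc.
by move: bl; rewrite bE /= la.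
Qed.

Lemma over_positionE : over_position w (crossing a) = index (mate a) w.
Proof.
apply: find_index => //; [exact: mem_mate|by rewrite /= eqxx la|].
move=> b bw /andP[/eqP bc /eqP bl]; have [bE|//] := same_crossing wf aw bw bc.
by move: bl; rewrite bE la.
Qed.

Lemma t_sgnE : t_sgn w (crossing a) = under_coef w a.
Proof.
rewrite /t_sgn /early_over over_positionE under_positionE /under_coef /writhe.
rewrite index_letter //.
suff -> : (Passage (crossing a) Over true \in w) = ~~ l2r a by case: (l2r a).
apply/idP/idP => [bw|nl].
  have [bE|bE] := same_crossing wf aw bw erefl; first by have := la; rewrite -bE.
  by move/(congr1 l2r): bE => /= <-.
have := mem_mate wf aw; rewrite /mate la; by rewrite nl.
Qed.
End Under.

(* The coefficient of the unknown of edge z, which leaves an underpass, in the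
   solution for edge e. *)
Let edge_value e z : laurent T :=
  (under_count e %% num_under == under_count z %% num_under)%N%:R *
  (<< 1 *g edge_degree e >> : laurent T).

Lemma classical_crossingsE :
  classical_crossings w = [seq crossing (letter w k) | k <- under_positions w].
Proof.
rewrite /classical_crossings -{1}(mkseq_nth (Passage 0 Over true) w) /mkseq.
by rewrite filter_map -map_comp.
Qed.

Lemma mem_under_positions k : (k \in under_positions w) = (k < size w)%N && under_at w k.
Proof. by rewrite mem_filter mem_iota add0n andbC. Qed.

(** Only the arc containing edge [e] contributes, and [edge_value] records its long arc and its
    degree. *)
Lemma sum_arcs (c : T) e z : (e <= size w)%N ->
  \sum_(b : Defs.arc w | long_arc w b == (under_count z %% num_under)%N)
     << (nat_of_ord b == arc_of_edge w e)%:R * c *g degree w b >> =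
  (<< c *g 0 >> : laurent T) * edge_value e z.
Proof.
move=> ew.
have lt_e : (arc_of_edge w e < (size (arc_ends w)).+1)%N.
  rewrite ltnS /arc_of_edge /arc_ends size_filter.
  by rewrite -[X in (_ <= count _ X)%N](cat_take_drop e) count_cat leq_addr.
rewrite big_mkcond (bigD1 (Ordinal lt_e)) //= big1 ?addr0 => [|b].
  rewrite eqxx mul1r long_arc_edge degree_edge /edge_value.
  case: eqP => _; last by rewrite mul0r mulr0.
  by rewrite mul1r laurent_monoM mulr1 add0r.
rewrite -val_eqE /= => /negPf ->; case: ifP => // _.
by rewrite mul0r monalgU0.
Qed.

(** The incidence coefficients 1, [t - 1] and [- t] are those of the relation of an underpass, for
    the edge leaving it, the edge entering the overpass and the edge entering it. So an entry is
    this relation with [edge_value] substituted. *)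
Lemma zeta_entryE k l : k \in under_positions w -> l \in under_positions w ->
  zeta_entry w (crossing (letter w k)) (crossing (letter w l)) =
  edge_value k.+1 l.+1 - edge_C w k.+1 * edge_value (edge_P w k.+1) l.+1
    - edge_G w k.+1 * edge_value (edge_Q w k.+1) l.+1.
Proof.
rewrite !mem_under_positions => /andP[kw ku] /andP[lw lu].
have lk : lev (letter w k) = Under by apply/eqP.
have ow : (index (mate (letter w k)) w <= size w)%N by exact: index_size.
rewrite /= over_coef_under // /passage_coef lk.
rewrite /zeta_entry /emanating_long_arc under_positionE // long_arc_edge.
rewrite /incidence /emanates_from /passes_over /comes_into.
rewrite over_positionE // !under_positionE // t_sgnE //.
move: (under_coef w _) => t.
under eq_bigr do rewrite !monalgUD.
rewrite !big_split /= !sum_arcs ?(ltnW kw) //.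
rewrite monalgUB monalgUN.
have -> : (<< 1 *g 0 >> : laurent T) = 1 by [].
ring.
Qed.

Lemma edge_value_step k z : (k < size w)%N -> ~~ under_at w k ->
  edge_value k.+1 z = passage_coef w (letter w k) * edge_value k z.
Proof.
move=> kw ku; rewrite /edge_value under_countS // edge_degreeS // (negPf ku) addn0.
rewrite mulrCA; congr (_ * _); move: ku; rewrite /under_at /passage_coef /degree_step.
case: (lev (letter w k)) => //= _; first by rewrite mul1r.
by rewrite laurent_monoM mulr1; case: (l2r _); rewrite [X in _ = << _ *g X >>]addrC.
Qed.

Lemma edge_value_last z : edge_value 0 z = edge_value (size w) z.
Proof. by rewrite /edge_value edge_degree_last under_count_last. Qed.

Lemma edge_value_under k l : k \in under_positions w -> l \in under_positions w ->
  edge_value k.+1 l.+1 = (k == l)%:R.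
Proof.
rewrite !mem_under_positions => /andP[kw ku] /andP[lw lu].
rewrite /edge_value under_count_eq // edge_degreeS // /degree_step (eqP ku).
by rewrite -[X in _ * X]/(1 : laurent T) mulr1.
Qed.

Let under_edges := [seq k.+1 | k <- under_positions w].

Lemma under_edgeS k : (k.+1 \in under_edges) = (k \in under_positions w).
Proof. by rewrite mem_map // => i j []. Qed.

(* Starting the list of the other edges right after an edge leaving an underpass
   makes their system triangular. *)
Lemma other_edges_det m : m \in under_edges ->
  label_det [seq x <- iota m ((size w).+1 - m) ++ iota 0 m | x \notin under_edges]
    (edge_system w) = 1.
Proof.
case/mapP => l; rewrite mem_under_positions => /andP[lw lu] -> {m}.
set s := _ ++ _.
pose r x y := (x \notin under_edges) ==> (edge_P w x != y).
have r_s : pairwise r s.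
  (* Edges increase within each stretch and refer to the preceding edge, except edge 0, which refers
     to the last edge; in the rotated list that one does not come after 0. *)
  have r_lt x y : (x < y)%N -> (x != 0%N) || (y != size w) -> r x y.
    rewrite /r; case: x => [|k] /= xy.
      by rewrite eq_sym => ->; rewrite implybT.
    by rewrite neq_ltn (ltnW xy) implybT.
  rewrite pairwise_cat; apply/and3P; split.
  - apply/allrelP => x y; rewrite !mem_iota add0n => /andP[lx _] yl; rewrite /r.
    case: x lx => [//|k] lk; apply/implyP; rewrite under_edgeS /= => ku.
    (* Only the first edge [l.+1] of the first stretch has its predecessor in the second one, and it
       leaves an underpass. *)
    apply: contraNneq ku => kE; have -> : k = l by lia.
    by rewrite mem_under_positions lw.
  - apply/(pairwiseP 0%N) => i j; rewrite !inE size_iota => il jl ij.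
    by rewrite !nth_iota //; apply: r_lt; rewrite ?ltn_add2l.
  - apply/(pairwiseP 0%N) => i j; rewrite !inE size_iota => il jl ij.
    by rewrite !nth_iota //; apply: r_lt; rewrite ?add0n //; lia.
have us : uniq s by apply: uniq_iota_rot; exact: leqW.
have G0 x : x \notin under_edges -> (x <= size w)%N -> edge_G w x = 0.
  case: x => [//|k]; rewrite under_edgeS mem_under_positions => ku kw.
  by rewrite /= over_coef0 // => lk; move: ku; rewrite kw /under_at lk.
have sw x : x \in s -> (x <= size w)%N.
  by rewrite mem_cat !mem_iota; lia.
apply: label_det_trig => [i j /andP[ij js]|x].
  set V := filter _ _ in js *.
  have iV : nth 0%N V i \in V by rewrite mem_nth // (ltn_trans ij).
  have jV : nth 0%N V j \in V by rewrite mem_nth.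
  have rV : r (nth 0%N V i) (nth 0%N V j).
    apply: (pairwiseP 0%N _) => //; last by rewrite inE (ltn_trans ij).
    exact: (subseq_pairwise (filter_subseq _ _)).
  have := iV; rewrite mem_filter => /andP[iU /sw iw].
  rewrite /edge_system /sparse nth_uniq ?filter_uniq ?(ltn_trans ij) //.
  rewrite (ltn_eqF ij) G0 // mul0r subr0 (negPf (implyP rV iU)).
  by rewrite mulr0 subr0.
rewrite mem_filter => /andP[xU /sw xw].
rewrite /edge_system /sparse eqxx G0 // mul0r subr0.
have -> : (edge_P w x == x) = false.
  by case: x {xU xw} => [|k] /=; [rewrite eqn0Ngt (leq_ltn_trans _ lw) | rewrite ltn_eqF].
by rewrite mulr0 subr0.
Qed.


(** The edges not leaving an underpass form a block of determinant 1, and [edge_value] solves their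
    relations; by [zeta_entryE] the other edges are left with the matrix of zeta. *)
Lemma zeta_edge_det : zeta w = edge_det w.
Proof.
have [k kP] : exists k, k \in under_positions w.
  have : (0 < size (under_positions w))%N.
    by move: classical; rewrite classical_crossingsE size_map.
  by case: (under_positions w) => // k s _; exists k; rewrite mem_head.
have mU : k.+1 \in under_edges by rewrite under_edgeS.
have := other_edges_det mU; set V := filter _ _ => detV.
have uU : uniq under_edges.
  by rewrite map_inj_uniq ?filter_uniq ?iota_uniq // => i j [].
have kw : (k < size w)%N by move: kP; rewrite mem_under_positions => /andP[].
have Uw x : x \in under_edges -> (x <= size w)%N.
  by case/mapP => l; rewrite mem_under_positions => /andP[lw _] ->.
have edgesE : perm_eq (edges w) (V ++ under_edges).
  apply: uniq_perm; rewrite ?iota_uniq ?cat_uniq ?uU ?andbT.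
  - by [].
  - rewrite filter_uniq /=.
      by apply/hasPn => x /= xU; rewrite mem_filter xU.
    by apply: uniq_iota_rot; exact: leqW.
  - move=> x; rewrite mem_edges mem_cat mem_filter mem_cat !mem_iota.
    by case: (boolP (x \in under_edges)) => [/Uw ->|_] /=; rewrite ?orbT ?orbF //; lia.
have PQ := edge_PQ wf; have uE := perm_uniq edgesE; rewrite iota_uniq in uE.
rewrite /edge_det (label_det_perm _ edgesE) (@sparse_peel _ _ _ _ _ _ _ edge_value) //.
- rewrite [X in X * _]detV mul1r label_det_map /zeta classical_crossingsE.
  rewrite -[LHS]/(label_det (map _ _) (zeta_entry w)) label_det_map.
  by apply: eq_label_det => i l iP lP; apply: zeta_entryE.
- by move=> x; rewrite -!(perm_mem edgesE); apply: PQ.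
- move=> _ _ /mapP[i iP ->] /mapP[l lP ->]; rewrite edge_value_under //.
- move=> x _ + /mapP[l lP ->]; rewrite mem_filter => /andP[xU].
  rewrite mem_cat !mem_iota add0n => xw; have {}xw : (x <= size w)%N by lia.
  case: x xU xw => [|i]; first by rewrite /= mul1r mul0r addr0 edge_value_last.
  rewrite under_edgeS mem_under_positions => iu iw; rewrite iw /= in iu.
  rewrite edge_value_step //= over_coef0 ?mul0r ?addr0 // => li.
  by rewrite /under_at li in iu.
Qed.
End ZetaEdge.

(** * First and second moves *)

(** The loop hands on the value of the edge entering it. Its block has determinant [1 - ga]: a power
    of [q] if the underpass is met first, and 1 otherwise. *)
Lemma edge_det_Omega1 u v a :
  well_formed (u ++ v) -> well_formed (u ++ [:: a; mate a] ++ v) ->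
  exists r, edge_det (u ++ [:: a; mate a] ++ v) = q_ r *: edge_det (u ++ v).
Proof.
(* This is an insertion whose second word is empty. *)
suff: well_formed (u ++ v ++ [::]) ->
    well_formed (u ++ [:: a; mate a] ++ v ++ [::] ++ [::]) ->
    exists r, edge_det (u ++ [:: a; mate a] ++ v ++ [::] ++ [::]) =
      q_ r *: edge_det (u ++ v ++ [::]) by rewrite /= !cats0.
move=> wf0 wf1; set w1 := u ++ [:: a; mate a] ++ v ++ [::] ++ [::] in wf1 *; pose i := size u.
have La : letter w1 i = a by exact: letter_cat.
have Lb : letter w1 i.+1 = mate a.
  have -> : w1 = (u ++ [:: a]) ++ mate a :: v ++ [::] by rewrite -catA.
  by rewrite /i -addn1 -(size_cat u [:: a]) letter_cat.
have sz : (i.+1 < size w1)%N by rewrite /w1 !size_cat /= -/i; lia.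
have Ia : index a w1 = i by rewrite -La index_letter // ltnW.
have Ib : index (mate a) w1 = i.+1 by rewrite -Lb index_letter.
pose ca := passage_coef w1 a; pose cb := passage_coef w1 (mate a).
pose ga := over_coef w1 a; pose gb := over_coef w1 (mate a).
(* The value of the edge inside the loop when the entering edge has value 1; [e1] and [e2] are the
   relations of the two inserted passages. *)
pose e := if lev a == Virtual then ca else 1.
have [e1 e2] : e = ca + ga * e /\ 1 = cb * e + gb.
  rewrite /e /ca /cb /ga /gb; case la: (lev a) => /=.
  - by rewrite over_coef0 ?la // passage_coef_over //
      (@over_coef_under _ (mate a)) /= ?la //; split; ring.
  - by rewrite (@over_coef0 _ (mate a)) /= ?la // (@passage_coef_over _ (mate a)) /= ?la //
      over_coef_under //; split; ring.
  - rewrite !over_coef0 /= ?la // mul0r !addr0; split=> //.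
    by rewrite mulrC passage_coef_virtualM /= ?la.
have : edge_det w1 = (1 - ga) * edge_det (u ++ v ++ [::]).
  pose E x y : laurent T := if x == i.+1 then e * (i == y)%:R else
    if x == i.+2 then (i == y)%:R else (x == y)%:R.
  rewrite (edge_det_insertion (E := E) wf0 wf1) -/w1 -/i.
  (* If [a] is an underpass, the edge leaving it is also the edge entering its overpass. This
     self-reference gives the diagonal entry [1 - ga]. *)
  - congr (_ * _); rewrite /inserted /= label_det2 /edge_system /sparse -/i.
    rewrite /= La Lb Ib mateK Ia -/ga -/gb !eqxx /=.
    have -> : (i == i.+1) = false by lia.
    have -> : (i == i.+2) = false by lia.
    have -> : (i.+1 == i.+2) = false by lia.
    rewrite /=; ring.
  - move=> k x; rewrite /E; have := new_edge_notin u [:: a; mate a] v [::] k.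
    by rewrite /inserted /= !inE negb_or => /andP[/negPf -> /negPf ->].
  - move=> x; rewrite /E /= addn2 eqxx.
    have -> : (i.+2 == i.+1) = false by lia.
    have -> : (i == i.+1) = false by lia.
    by have -> : (i == i.+2) = false by lia.
  - move=> x; rewrite /E /new_edge /= -/i addn0.
    case: ltngtP => [vi||vi].
    + lia.
    + by rewrite leqnn.
    + rewrite vi addn2 addn0 eqxx.
      have -> : (i.+2 == i.+1) = false by lia.
      have -> : (i == i.+1) = false by lia.
      by have -> : (i == i.+2) = false by lia.
  - move=> x; rewrite /inserted /= !inE -/i => /orP[] /eqP -> z.
    + rewrite /= La Ib -/ca -/ga /E eqxx.
      have -> : (i == i.+1) = false by lia.
      have -> : (i == i.+2) = false by lia.
      rewrite {1}e1; ring.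
    + rewrite /= Lb mateK Ia -/cb -/gb /E !eqxx.
      have -> : (i.+2 == i.+1) = false by lia.
      have -> : (i == i.+1) = false by lia.
      have -> : (i == i.+2) = false by lia.
      by rewrite mulrA -mulrDl -e2 mul1r.
move=> ->.
case: (eqVneq (lev a) Under) => [la|la]; last first.
  by exists 0; rewrite q_0 scale1r /ga over_coef0 ?subr0 ?mul1r //; apply/eqP.
(* The overpass comes right after [a], so the crossing is an early undercrossing and the factor is a
   power of [q]. *)
rewrite /ga over_coef_under // subKr /passage_coef la /under_coef Ia Ib.
rewrite ltnNge leqW //=; eexists; exact/esym/laurent_scaleE.
Qed.

(** The crossings of a second move are both early over or both early under and have opposite signs,
    so their coefficients are inverse to each other. *)
Lemma under_coefM w a b :
  (index (mate a) w < index a w)%N = (index (mate b) w < index b w)%N ->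
  l2r b = ~~ l2r a -> under_coef w a * under_coef w b = 1.
Proof.
rewrite /under_coef => -> ->.
by case: ifP; case: (l2r a); rewrite -?p_D -?q_D ?p_0 ?q_0.
Qed.

Lemma passage_coefM w a b :
  (index (mate a) w < index a w)%N = (index (mate b) w < index b w)%N ->
  lev a = lev b -> l2r b = ~~ l2r a ->
  passage_coef w a * passage_coef w b = 1.
Proof.
move=> early; case la: (lev a) => /esym lb ab.
- by rewrite !passage_coef_over // mulr1.
- by rewrite /passage_coef la lb laurent_monoM under_coefM.
- exact: passage_coef_virtualM.
Qed.

(** For inverse [t] and [t'] one has [t' (1 - t) + (1 - t') = 0]: what the upper strand adds at one
    crossing is removed at the other. *)
Lemma over_coefM w a b :
  (index (mate a) w < index a w)%N = (index (mate b) w < index b w)%N ->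
  lev a = lev b -> l2r b = ~~ l2r a ->
  passage_coef w b * over_coef w a + over_coef w b = 0.
Proof.
move=> early lab ab; have := passage_coefM early lab ab; rewrite /over_coef -lab.
case: eqP => _ M1; last by rewrite mulr0 addr0.
by rewrite mulrBr mulr1 [_ * passage_coef w a]mulrC M1 addrA subrK subrr.
Qed.

Lemma edge_neqs i j : (i <= j)%N -> ((i == i.+1) = false) * ((i == i.+2) = false) *
    ((i == j.+3) = false) * ((i == j.+4) = false) *
    ((i.+2 == i.+1) = false) * ((i.+1 == i.+2) = false) *
    ((j.+2 == i.+1) = false) * ((j.+2 == j.+3) = false) *
    ((j.+2 == j.+4) = false) * ((j.+3 == i.+1) = false) *
    ((j.+3 == i.+2) = false) * ((j.+4 == i.+1) = false) *
    ((j.+4 == i.+2) = false) * ((j.+4 == j.+3) = false) *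
    ((j.+3 == j.+4) = false) * ((i.+1 == j.+4) = false) *
    ((i.+1 == j.+3) = false) * ((i.+2 == j.+4) = false) *
    ((i.+2 == j.+3) = false).
Proof. by move=> ij; do !split; apply/eqP; lia. Qed.


(** The coefficients along each strand multiply to 1 and the contributions of the upper strand to
    the lower one cancel. So both strands leave with their entering values, and the inserted block
    has determinant 1. *)
Lemma edge_det_Omega2 u v w a b (parallel : bool) :
  lev a = lev b -> l2r b = ~~ l2r a -> well_formed (u ++ v ++ w) ->
  well_formed (u ++ [:: a; b] ++ v ++ ordered parallel (mate a) (mate b) ++ w) ->
  edge_det (u ++ [:: a; b] ++ v ++ ordered parallel (mate a) (mate b) ++ w) =
  edge_det (u ++ v ++ w).
Proof.
move=> lab ab wf0.
pose c := if parallel then mate a else mate b.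
pose d := if parallel then mate b else mate a.
have -> : ordered parallel (mate a) (mate b) = [:: c; d].
  by rewrite /ordered /c /d; case: ifP.
set w1 := u ++ [:: a; b] ++ v ++ [:: c; d] ++ w => wf1.
pose i := size u; pose j := (size u + size v)%N.
have La : letter w1 i = a by exact: letter_cat.
have Lb : letter w1 i.+1 = b.
  have -> : w1 = (u ++ [:: a]) ++ b :: v ++ [:: c; d] ++ w by rewrite -catA.
  by rewrite /i -addn1 -(size_cat u [:: a]) letter_cat.
have Lc : letter w1 j.+2 = c.
  have -> : w1 = (u ++ [:: a; b] ++ v) ++ c :: d :: w by rewrite /w1 -!catA.
  have -> : j.+2 = size (u ++ [:: a; b] ++ v) by rewrite !size_cat /j /=; lia.
  exact: letter_cat.
have Ld : letter w1 j.+3 = d.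
  have -> : w1 = (u ++ [:: a; b] ++ v ++ [:: c]) ++ d :: w by rewrite /w1 -!catA.
  have -> : j.+3 = size (u ++ [:: a; b] ++ v ++ [:: c]) by rewrite !size_cat /j /=; lia.
  exact: letter_cat.
have sz : (j.+3 < size w1)%N by rewrite /w1 !size_cat /= /j; lia.
have ij : (i <= j)%N by exact: leq_addr.
have Ia : index a w1 = i by rewrite -La index_letter //; lia.
have Ib : index b w1 = i.+1 by rewrite -Lb index_letter //; lia.
have Ic : index c w1 = j.+2 by rewrite -Lc index_letter //; lia.
have Id : index d w1 = j.+3 by rewrite -Ld index_letter //; lia.
have Ima : index (mate a) w1 = if parallel then j.+2 else j.+3.
  by move: Ic Id; rewrite /c /d; case: ifP => _.
have Imb : index (mate b) w1 = if parallel then j.+3 else j.+2.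
  by move: Ic Id; rewrite /c /d; case: ifP => _.
have Imc : index (mate c) w1 = if parallel then i else i.+1.
  by rewrite /c; case: ifP => _; rewrite mateK.
have Imd : index (mate d) w1 = if parallel then i.+1 else i.
  by rewrite /d; case: ifP => _; rewrite mateK.
have lcd : lev c = lev d by rewrite /c /d; case: ifP => _; rewrite /= lab.
have cd : l2r d = ~~ l2r c.
  by rewrite /c /d; case: ifP => _; rewrite /= ab ?negbK.
have earlyab : (index (mate a) w1 < index a w1)%N = (index (mate b) w1 < index b w1)%N.
  by rewrite Ima Imb Ia Ib; case: ifP => _; lia.
have earlycd : (index (mate c) w1 < index c w1)%N = (index (mate d) w1 < index d w1)%N.
  by rewrite Imc Imd Ic Id; case: ifP => _; lia.
pose Ca := passage_coef w1 a; pose Cb := passage_coef w1 b.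
pose Cc := passage_coef w1 c; pose Cd := passage_coef w1 d.
pose Ga := over_coef w1 a; pose Gb := over_coef w1 b.
pose Gc := over_coef w1 c; pose Gd := over_coef w1 d.
have Cab : Ca * Cb = 1 by exact: passage_coefM.
have Ccd : Cc * Cd = 1 by exact: passage_coefM.
have Gab : Gb = - (Cb * Ga).
  by apply/eqP; rewrite -subr_eq0 opprK addrC; apply/eqP; exact: over_coefM.
have Gcd : Gd = - (Cd * Gc).
  by apply/eqP; rewrite -subr_eq0 opprK addrC; apply/eqP; exact: over_coefM.
(* The crossings are virtual, or the first strand is above, or the second one is. *)
have layers : (Ga = 0 /\ Gc = 0) \/ (Ga = 0 /\ Ca = 1) \/ (Gc = 0 /\ Cc = 1).
  have lc : lev c = lev (mate a) by rewrite /c; case: ifP => _; rewrite /= ?lab.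
  rewrite /Ga /Gc /Ca /Cc /over_coef /passage_coef lc /=.
  by case: (lev a) => /=; [right; left|right; right|left].
(* The old name of the edge entering the second pair of passages; if [v] is empty, this is the edge
   entering the first pair. *)
pose dj := if (j <= i)%N then j else j.+2.
pose E x y : laurent T :=
  if x == i.+1 then Ca * (i == y)%:R + Ga * (dj == y)%:R else
  if x == i.+2 then (i == y)%:R else
  if x == j.+3 then Cc * (dj == y)%:R + Gc * (i == y)%:R else
  if x == j.+4 then (dj == y)%:R else (x == y)%:R.
have neqs := edge_neqs ij.
have Ei y : E i y = (i == y)%:R by rewrite /E !neqs.
have Ei1 y : E i.+1 y = Ca * (i == y)%:R + Ga * (dj == y)%:R by rewrite /E eqxx.
have Ei2 y : E i.+2 y = (i == y)%:R by rewrite /E !neqs eqxx.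
have Ej2 y : E j.+2 y = (dj == y)%:R.
  case: (eqVneq i j) => [eij|nij].
    by rewrite /dj -eij Ei2 leqnn.
  by rewrite /E /dj leqNgt ltn_neqAle nij ij /= !neqs eqSS eqSS eq_sym (negPf nij).
have Ej3 y : E j.+3 y = Cc * (dj == y)%:R + Gc * (i == y)%:R.
  by rewrite /E !neqs eqxx.
have Ej4 y : E j.+4 y = (dj == y)%:R by rewrite /E !neqs eqxx.
have djE : new_edge u [:: a; b] v [:: c; d] j = dj.
  by rewrite /new_edge /dj -/i -/j leqnn; case: ifP => _; rewrite ?addn0 ?addn2.
have Enew k y : E (new_edge u [:: a; b] v [:: c; d] k) y =
    (new_edge u [:: a; b] v [:: c; d] k == y)%:R.
  rewrite /E; have := new_edge_notin u [:: a; b] v [:: c; d] k.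
  rewrite /inserted /= -/i -/j addn2 !inE !negb_or.
  by case/and4P => /negPf -> /negPf -> /negPf -> /negPf ->.
rewrite (edge_det_insertion (E := E) wf0 wf1) -/w1 -/i -/j //=.
- rewrite -[RHS]mul1r; congr (_ * _); rewrite /inserted /= -/i -/j addn2.
  rewrite (@label_det_perm _ _ [:: j.+3; j.+4; i.+1; i.+2]); last first.
    by rewrite -[X in perm_eq X]/([:: _; _] ++ [:: _; _]) perm_catC.
  rewrite label_det4 /edge_system /sparse /= ?La ?Lb ?Lc ?Ld ?Ima ?Imb ?Imc ?Imd ?neqs ?eqxx.
  (* The bit [t] says that [v] is empty; then the edge leaving the first pair is the one entering
     the second pair. *)
  + rewrite -/Ca -/Cb -/Cc -/Cd -/Ga -/Gb -/Gc -/Gd ; have tE : (j == i) = (j.+2 == i.+2) by [].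
    rewrite -!tE; move: (j == i) tE => t tE.
    case: layers => [[Ga0 Gc0]|[[Ga0 Ca1]|[Gc0 Cc1]]].
    * by rewrite Gab Ga0 Gc0; case: ifP => _; rewrite ?neqs /=; ring.
    * by rewrite Gab Ga0; case: ifP => _; rewrite ?neqs /=; ring.
    * by rewrite Gab Gc0 Cc1; case: ifP => _; rewrite ?neqs ?eqxx /= -?tE; ring.
  + by rewrite /= !inE !neqs.
  + by case: ifP => _; rewrite ?neqs /=; ring.
  + by case: ifP => _; rewrite ?neqs /=; ring.
  + by case: ifP => _; rewrite ?neqs /=; ring.
  + by case: ifP => _; rewrite ?neqs /=; ring.
  + by case: ifP => _; rewrite ?neqs /=; ring.
- by move=> y; rewrite addn2 Ei Ei2.
- by move=> y; rewrite !addn2 Enew djE Ej4.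
- move=> x; rewrite /inserted /= -/i -/j addn2 !inE.
  case/or4P => /eqP -> z /=.
  + rewrite Ei1 La Ima -/Ca -/Ga Ei.
    case: layers => [[-> _]|[[-> _]|[Gc0 Cc1]]]; rewrite ?mul0r ?addr0 //.
    by case: ifP => _; rewrite ?Ej2 // Ej3 Gc0 Cc1 mul0r addr0 mul1r.
  + rewrite Ei2 Lb Imb -/Cb -/Gb Ei1.
    rewrite [X in _ = _ + X](_ : _ = Gb * (dj == z)%:R); last first.
      rewrite Gab; case: layers => [[-> _]|[[-> _]|[Gc0 Cc1]]]; rewrite ?mulr0 ?oppr0 ?mul0r //.
      by case: ifP => _; rewrite ?Ej2 // Ej3 Gc0 Cc1 mul0r addr0 mul1r.
    by rewrite Gab mulrDr mulNr !mulrA addrK [Cb * Ca]mulrC Cab mul1r.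
  + rewrite Ej3 Lc Imc -/Cc -/Gc Ej2.
    case: layers => [[_ ->]|[[Ga0 Ca1]|[-> _]]]; rewrite ?mul0r ?addr0 //.
    by case: ifP => _; rewrite ?Ei // Ei1 Ga0 Ca1 mul0r addr0 mul1r.
  + rewrite Ej4 Ld Imd -/Cd -/Gd Ej3.
    rewrite [X in _ = _ + X](_ : _ = Gd * (i == z)%:R); last first.
      rewrite Gcd; case: layers => [[_ ->]|[[Ga0 Ca1]|[-> _]]]; rewrite ?mulr0 ?oppr0 ?mul0r //.
      by case: ifP => _; rewrite ?Ei // Ei1 Ga0 Ca1 mul0r addr0 mul1r.
    by rewrite Gcd mulrDr mulNr !mulrA addrK [Cd * Cc]mulrC Ccd mul1r.
Qed.

(** * Third move *)

(* The strands of a third move are the top T, the middle M and the bottom B; for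
   a crossing of strands I and J, the index IJ refers to the passage of I.  Strand
   I enters by edge pI, then goes through pI.+1 and leaves by pI.+2.  The bits fT,
   fM, fB say that TM, MT, BT come first on their strands. *)
Section ThirdSystem.
Variable R : comNzRingType.
Variables (pT pM pB : nat) (cTM cTB cMT cMB cBT cBM gMT gBT gBM : R).

Definition apart p p' := (p.+1 < p')%N || (p'.+1 < p)%N.
Hypotheses (apTM : apart pT pM) (apTB : apart pT pB) (apMB : apart pM pB).

Definition mids := [:: pT.+1; pM.+1; pB.+1].
Definition outs := [:: pT.+2; pM.+2; pB.+2].

Record third_system (fT fM fB : bool) (C G : nat -> R) (P Q : nat -> nat) : Prop :=
  ThirdSystem {
    third_P : {in [:: pT; pM; pB], forall p, P p.+1 = p /\ P p.+2 = p.+1};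
    third_CT : (C pT.+1, C pT.+2) = if fT then (cTM, cTB) else (cTB, cTM);
    third_GT : G pT.+1 = 0 /\ G pT.+2 = 0;
    third_CM : (C pM.+1, C pM.+2) = if fM then (cMT, cMB) else (cMB, cMT);
    third_GM : (G pM.+1, G pM.+2) = if fM then (gMT, 0) else (0, gMT);
    third_QM : Q (if fM then pM.+1 else pM.+2) = if fT then pT else pT.+1;
    third_CB : (C pB.+1, C pB.+2) = if fB then (cBT, cBM) else (cBM, cBT);
    third_GB : (G pB.+1, G pB.+2) = if fB then (gBT, gBM) else (gBM, gBT);
    third_QBT : Q (if fB then pB.+1 else pB.+2) = if fT then pT.+1 else pT;
    third_QBM : Q (if fB then pB.+2 else pB.+1) = if fM then pM.+1 else pM
  }.

Lemma third_neqs :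
  let ne (x y : nat) := (((x == y) = false) * ((y == x) = false))%type in
  (ne pT pT.+1 * ne pT pM.+1 * ne pT pB.+1 * ne pM pT.+1 * ne pM pM.+1 *
  ne pM pB.+1 * ne pB pT.+1 * ne pB pM.+1 * ne pB pB.+1 * ne pM.+1 pT.+1 *
  ne pB.+1 pT.+1 * ne pB.+1 pM.+1 * ne pM.+2 pT.+2 * ne pB.+2 pT.+2 *
  ne pB.+2 pM.+2 * (((pT.+2 == pT.+1) = false) * ((pM.+2 == pM.+1) = false) *
  ((pB.+2 == pB.+1) = false)))%type.
Proof.
move: apTM apTB apMB; rewrite /apart => *.
by do !split; apply/eqP; lia.
Qed.

Let d (x z : nat) : R := (x == z)%:R.

Section Reduce.
Variables (fT fM fB : bool) (C G : nat -> R) (P Q : nat -> nat).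


(** Values in terms of the edges entering the triangle: [at_IJ] is that of the edge entering the
    passage of [I] across [J], and [out_I] that of the edge by which [I] leaves. *)
Definition at_TM z := (if fT then 1 else cTB) * d pT z.
Definition at_TB z := (if fT then cTM else 1) * d pT z.
Definition at_MB z := if fM then cMT * d pM z + gMT * at_TM z else d pM z.
Definition out_M z := if fM then cMB * (cMT * d pM z + gMT * at_TM z)
  else cMT * (cMB * d pM z) + gMT * at_TM z.
Definition out_B z :=
  if fB then cBM * (cBT * d pB z + gBT * at_TB z) + gBM * at_MB z
  else cBT * (cBM * d pB z + gBM * at_MB z) + gBT * at_TB z.
Definition out_row x z :=
  if x == pT.+2 then cTM * cTB * d pT z else
  if x == pM.+2 then out_M z else
  if x == pB.+2 then out_B z else C x * d (P x) z + G x * d (Q x) z.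

Definition mid_values x z :=
  if x == pT.+1 then (if fT then cTM else cTB) * d pT z else
  if x == pM.+1 then
    if fM then cMT * d pM z + gMT * at_TM z else cMB * d pM z else
  if x == pB.+1 then
    if fB then cBT * d pB z + gBT * at_TB z else cBM * d pB z + gBM * at_MB z
  else d x z.

End Reduce.

(** Eliminates the three inner edges of the triangle. Relations elsewhere do not refer to them, so
    only those of the outgoing edges change. *)
Lemma third_reduce fT fM fB C G P Q s : third_system fT fM fB C G P Q ->
  uniq s -> {subset mids <= s} ->
  {in s, forall x, (P x \in s) && (Q x \in s)} ->
  {in s, forall x, x \notin mids ++ outs -> P x \notin mids /\ Q x \notin mids} ->
  label_det s (sparse C G P Q) =
  label_det [seq x <- s | x \notin mids]
    (fun x z => d x z - out_row fT fM fB C G P Q x z).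
Proof.
move=> sysP us ms PQ away; set U := filter _ _.
have neqs := third_neqs.
have um : uniq mids by rewrite /mids /= !inE !neqs.
have sE : perm_eq s (mids ++ U).
  apply: uniq_perm => //.
    rewrite cat_uniq um filter_uniq // andbT; apply/hasPn => x /=.
    by rewrite mem_filter => /andP[].
  move=> x; rewrite mem_cat mem_filter; case: (boolP (x \in mids)) => //=.
  exact: ms.
have [PT1 PT2] := third_P sysP (mem_head _ _).
have [PM1 PM2] : P pM.+1 = pM /\ P pM.+2 = pM.+1.
  by apply: (third_P sysP); rewrite !inE eqxx orbT.
have [PB1 PB2] : P pB.+1 = pB /\ P pB.+2 = pB.+1.
  by apply: (third_P sysP); rewrite !inE eqxx !orbT.
pose E := mid_values fT fM fB.
have Eout x z : x \notin mids -> E x z = d x z.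
  rewrite /mids !inE !negb_or => /and3P[/negPf x1 /negPf x2 /negPf x3].
  by rewrite /E /mid_values x1 x2 x3.
have ET1 z : E pT.+1 z = (if fT then cTM else cTB) * d pT z.
  by rewrite /E /mid_values eqxx.
have EM1 z : E pM.+1 z =
    if fM then cMT * d pM z + gMT * at_TM fT z else cMB * d pM z.
  by rewrite /E /mid_values !neqs eqxx.
have EB1 z : E pB.+1 z = if fB then cBT * d pB z + gBT * at_TB fT z
    else cBM * d pB z + gBM * at_MB fT fM z.
  by rewrite /E /mid_values !neqs eqxx.
have [ET EM EB] : [/\ E pT =1 d pT, E pM =1 d pM & E pB =1 d pB].
  by split=> z; apply: Eout; rewrite /mids !inE !neqs.
have [GT1 GT2] := third_GT sysP.
have [QM QBT QBM] := And3 (third_QM sysP) (third_QBT sysP) (third_QBM sysP).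
have [CT CM CB] := And3 (third_CT sysP) (third_CM sysP) (third_CB sysP).
have [GM GB] := conj (third_GM sysP) (third_GB sysP).
have QT z : E (if fT then pT else pT.+1) z = at_TM fT z.
  by rewrite /at_TM; case: ifP ET1 => fE ET1; rewrite ?ET ?ET1 ?mul1r.
have QT' z : E (if fT then pT.+1 else pT) z = at_TB fT z.
  by rewrite /at_TB; case: ifP ET1 => fE ET1; rewrite ?ET ?ET1 ?mul1r.
have QM' z : E (if fM then pM.+1 else pM) z = at_MB fT fM z.
  by rewrite /at_MB; case: ifP EM1 => fE EM1; rewrite ?EM ?EM1.
have [vT1 vT2] : (forall z, E pT.+1 z = C pT.+1 * d pT z) /\
    (forall z, cTM * cTB * d pT z = C pT.+2 * E pT.+1 z).
  by split=> z; rewrite !ET1; move: CT; case: ifP => _ [C1 C2]; rewrite ?C1 ?C2 //; ring.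
have [vM1 vM2] : (forall z, E pM.+1 z = C pM.+1 * d pM z + G pM.+1 * E (Q pM.+1) z) /\
    (forall z, out_M fT fM z = C pM.+2 * E pM.+1 z + G pM.+2 * E (Q pM.+2) z).
  rewrite /out_M; split=> z; rewrite !EM1 -(QT z) -QM; move: CM GM;
  by case: ifP => _ [C1 C2] [G1 G2]; rewrite ?C1 ?C2 ?G1 ?G2 //; ring.
have [vB1 vB2] : (forall z, E pB.+1 z = C pB.+1 * d pB z + G pB.+1 * E (Q pB.+1) z) /\
    (forall z, out_B fT fM fB z = C pB.+2 * E pB.+1 z + G pB.+2 * E (Q pB.+2) z).
  rewrite /out_B; split=> z; rewrite !EB1 -(QT' z) -(QM' z) -QBT -QBM; move: CB GB;
  by case: ifP => _ [C1 C2] [G1 G2]; rewrite ?C1 ?C2 ?G1 ?G2 //; ring.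
rewrite (label_det_perm _ sE) (@sparse_peel _ _ _ _ _ _ _ E).
(* In the order top, middle, bottom the block is unitriangular: no inner edge refers to an inner
   edge of a lower strand. *)
- rewrite label_det_trig ?mul1r.
  + apply: eq_label_det => x z; rewrite mem_filter => /andP[xm xs] _.
    rewrite Eout // -addrA -opprD; congr (_ - _); rewrite /out_row.
    case: (eqVneq x pT.+2) => [->|xT].
      by rewrite PT2 GT2 mul0r addr0 vT2.
    case: (eqVneq x pM.+2) => [->|xM].
      by rewrite PM2 vM2.
    case: (eqVneq x pB.+2) => [->|xB].
      by rewrite PB2 vB2.
    have [] := away x xs; first by rewrite mem_cat negb_or xm /outs !inE !negb_or xT xM xB.
    by move=> Pm Qm; rewrite !Eout.
  + have M1 z : z != pM -> z != pT -> z != pT.+1 -> G pM.+1 * (Q pM.+1 == z)%:R = 0.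
      move=> zM zT zT1; move: GM QM; case: ifP => _ [-> _]; last by rewrite mul0r.
      by move=> ->; case: ifP => _; rewrite eq_sym ?(negPf zT) ?(negPf zT1) mulr0.
    case=> [|[|[|i]]] [|[|[|j]]] //=; rewrite ?andbF // => _; rewrite /sparse ?PT1 ?PM1 !neqs ?GT1.
    + by rewrite !(mulr0, mul0r, subr0).
    + by rewrite !(mulr0, mul0r, subr0).
    + by rewrite M1 ?neqs // !(mulr0, subr0).
  + have BB : (Q pB.+1 == pB.+1) = false.
      move: QBT QBM; case: ifP => _; first by move=> -> _; case: ifP; rewrite !neqs.
      by move=> _ ->; case: ifP; rewrite !neqs.
    have MM : G pM.+1 * (Q pM.+1 == pM.+1)%:R = 0.
      move: GM QM; case: ifP => _ [-> _]; last by rewrite mul0r.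
      by move=> ->; case: ifP => _; rewrite !neqs mulr0.
    move=> x; rewrite /mids !inE => /or3P[] /eqP ->; rewrite /sparse eqxx.
    * by rewrite PT1 GT1 !neqs mul0r mulr0 !subr0.
    * by rewrite PM1 MM !neqs mulr0 !subr0.
    * by rewrite PB1 BB !neqs !mulr0 !subr0.
- by rewrite -(perm_uniq sE).
- by move=> x; rewrite -!(perm_mem sE); apply: PQ.
- by move=> x z; rewrite mem_filter => /andP[xm _] _; apply: Eout.
- move=> x z; rewrite /mids !inE => /or3P[] /eqP -> _.
  + by rewrite PT1 GT1 mul0r addr0 ET vT1.
  + by rewrite PM1 EM vM1.
  + by rewrite PB1 EB vB1.
Qed.

(** After elimination only the rows of the outgoing edges have to be compared. For the top and the
    middle strand they agree by commutativity and the hypothesis on the levels; for the bottom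
    strand they differ by multiples of the product with [gBM], which is assumed to vanish. *)
Lemma third_invariance fT fM fB C G P Q C' G' P' Q' s :
  third_system fT fM fB C G P Q ->
  third_system (~~ fT) (~~ fM) (~~ fB) C' G' P' Q' ->
  uniq s -> {subset mids <= s} ->
  {in s, forall x, (P x \in s) && (Q x \in s)} ->
  {in s, forall x, (P' x \in s) && (Q' x \in s)} ->
  {in s, forall x, x \notin mids ++ outs -> P x \notin mids /\ Q x \notin mids} ->
  {in s, forall x, x \notin mids ++ outs ->
    [/\ C x = C' x, G x = G' x, P x = P' x & Q x = Q' x]} ->
  gBM * (if fM == fB then cBT - cMT else 1 - cBT * cMT) = 0 ->
  [/\ cTM = 1, cTB = 1, cMB = 1 & [/\ gMT = 1 - cMT, gBT = 1 - cBT & gBM = 1 - cBM]]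
    \/ gMT = 0 /\ gBT = 0 ->
  label_det s (sparse C G P Q) = label_det s (sparse C' G' P' Q').
Proof.
move=> sys sys' us ms PQ PQ' away same rel levels.
have away' : {in s, forall x, x \notin mids ++ outs ->
    P' x \notin mids /\ Q' x \notin mids}.
  by move=> x xs xmo; have [_ _ <- <-] := same x xs xmo; apply: away.
rewrite (third_reduce sys) // (third_reduce sys') //.
apply: eq_label_det => x z; rewrite mem_filter => /andP[xm xs] _; congr (_ - _).
rewrite /out_row; case: (eqVneq x pT.+2) => [//|xT].
case: (eqVneq x pM.+2) => [_|xM].
  rewrite /out_M /at_TM; case: levels => [[E1 E2 E3 _]|[E1 _]];
  by case: (fT); case: (fM); rewrite /= ?E1 ?E2 ?E3; ring.
case: (eqVneq x pB.+2) => [_|xB].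
  rewrite /out_B /at_MB /at_TM /at_TB.
  (* The relation is rewritten with a monomial on the left, the form in which [ring] can use it. *)
  have {rel} : if fM == fB then gBM * cMT = gBM * cBT else gBM * cBT * cMT = gBM.
    by case: eqP rel => _ /eqP; rewrite mulrBr ?mulr1 subr_eq0 ?mulrA => /eqP.
  case: levels => [[E1 E2 E3 [E4 E5 E6]]|[E4 E5]].
    have E7 : cBM = 1 - gBM by rewrite E6; ring.
    case: (fT); case: (fM); case: (fB) => /= rel;
      rewrite ?E1 ?E2 ?E4 ?E5 ?E7; ring: rel.
  by case: (fT); case: (fM); case: (fB) => /= rel; rewrite ?E4 ?E5; ring: rel.
have [|-> -> -> ->] := same x xs; last by [].
by rewrite mem_cat negb_or xm /outs !inE !negb_or xT xM xB.
Qed.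

End ThirdSystem.

(** * Positions of the strands and relations in [T] for the third move *)

Lemma letter_index (w : word) a : a \in w -> letter w (index a w) = a.
Proof. exact: nth_index. Qed.

Lemma apart_lt p p' x y : apart p p' -> (p <= x <= p.+1)%N ->
  (p' <= y <= p'.+1)%N -> (x < y)%N = (p < p')%N.
Proof. by rewrite /apart; lia. Qed.

(** Everything reduces to the two defining relations: with [p'] and [q'] the inverses, [1 - p'] is a
    multiple of [p - 1], [1 - q'] of [q - 1], and [p' - q'] of [p - q]. *)
Lemma under_coef_layers (R : comNzRingType) (p p' q q' : R) :
  p * p' = 1 -> q * q' = 1 -> (p - 1) * (p - q) = 0 -> (q - 1) * (p - q) = 0 ->
  forall t, [\/ t = p, t = p', t = q | t = q'] ->
  (1 - t) * (p - q) = 0 /\ (1 - t) * (p' - q') = 0.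
Proof.
move=> pp qq rp rq.
have dE : p' - q' = - (p' * q') * (p - q).
  rewrite mulrBr !mulNr opprK mulrAC [p' * p]mulrC pp -mulrA [q' * q]mulrC qq; ring.
have pE : 1 - p' = p' * (p - 1) by rewrite mulrBr [p' * p]mulrC pp mulr1.
have qE : 1 - q' = q' * (q - 1) by rewrite mulrBr [q' * q]mulrC qq mulr1.
move=> t tE.
have tpq : (1 - t) * (p - q) = 0.
  case: tE => ->.
  - by rewrite -opprB mulNr rp oppr0.
  - by rewrite pE -mulrA rp mulr0.
  - by rewrite -opprB mulNr rq oppr0.
  - by rewrite qE -mulrA rq mulr0.
by split=> //; rewrite dE mulrCA tpq mulr0.
Qed.

Lemma under_coef_layer w a :
  (1 - under_coef w a) * (p_ 1 - q_ 1) = 0 /\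
  (1 - under_coef w a) * (p_ (-1) - q_ (-1)) = 0.
Proof.
have pp : p_ 1 * p_ (-1) = 1 by rewrite -p_D p_0.
have qq : q_ 1 * q_ (-1) = 1 by rewrite -q_D q_0.
apply: (under_coef_layers pp qq T_rel_p T_rel_q).
rewrite /under_coef; case: ifP => _; case: (l2r a);
[constructor 2|constructor 1|constructor 4|constructor 3]; reflexivity.
Qed.

(** Equal directions give equal exponents, so the second factor is 0 or, up to sign, the difference
    of the same power of [p] and [q]. *)
Lemma under_coefB w a b c : l2r b = l2r c ->
  (1 - under_coef w a) * (under_coef w b - under_coef w c) = 0.
Proof.
have := under_coef_layer w a; move: (under_coef w a) => t.
rewrite /under_coef => -[r1 r2] ->.
case: (l2r c) => /=; move: (p_ 1) (q_ 1) (p_ (-1)) (q_ (-1)) r1 r2 => p q p' q' r1 r2;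
case: ifP => _; case: ifP => _; rewrite ?subrr ?mulr0 //;
by rewrite -[X in _ * X]opprB mulrN ?r1 ?r2 oppr0.
Qed.

(** Opposite directions give opposite exponents, so the inner product is 1 or a quotient of [p] and
    [q], and the second factor is a multiple of [p - q]. *)
Lemma under_coefBM w a b c : l2r b = ~~ l2r c ->
  (1 - under_coef w a) * (1 - under_coef w b * under_coef w c) = 0.
Proof.
have pp : p_ 1 * p_ (-1) = 1 by rewrite -p_D p_0.
have qq : q_ 1 * q_ (-1) = 1 by rewrite -q_D q_0.
have [r _] := under_coef_layer w a; move: (under_coef w a) r => t r.
rewrite /under_coef => ->.
case: (l2r c) => /=; move: (p_ 1) (q_ 1) (p_ (-1)) (q_ (-1)) pp qq r => p q p' q' pp qq r.
- have E1 : 1 - p * q' = - ((p - q) * q') by rewrite mulrBl qq opprB.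
  have E2 : 1 - q * p' = (p - q) * p' by rewrite mulrBl pp.
  by case: ifP => _; case: ifP => _;
    rewrite ?pp ?qq ?E1 ?E2 ?subrr ?mulr0 // ?mulrN mulrA r mul0r ?oppr0.
- have E1 : 1 - p' * q = (p - q) * p' by rewrite mulrBl pp [q * _]mulrC.
  have E2 : 1 - q' * p = - ((p - q) * q') by rewrite mulrBl qq opprB [p * _]mulrC.
  by case: ifP => _; case: ifP => _;
    rewrite ?[p' * p]mulrC ?[q' * q]mulrC ?pp ?qq ?E1 ?E2 ?subrr ?mulr0 //
      ?mulrN mulrA r mul0r ?oppr0.
Qed.

(** The triangle links the directions to the bits [fM] and [fB]. If the top strand is classical, the
    relations of [T] apply; if it is virtual, the two coefficients are equal or inverse powers of
    [s], and the second factor already vanishes. *)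
Lemma third_relation (w : word) (tm tb mb : passage) (fM fB : bool) :
  (fM == fB) = (l2r tm == l2r tb) ->
  [/\ lev tm = Over, lev tb = Over & lev mb = Over] \/
    lev tm = Virtual /\ lev tb = Virtual ->
  over_coef w (mate mb) *
    (if fM == fB then passage_coef w (mate tb) - passage_coef w (mate tm)
     else 1 - passage_coef w (mate tb) * passage_coef w (mate tm)) = 0.
Proof.
(* The embedding of [T] as constants moves the computation into [T]. *)
have [f monoE] : exists f : {rmorphism T -> laurent T},
    forall c : T, (<< c *g 0 >> : laurent T) = f c.
  by exists (in_alg (laurent T)) => c; rewrite /= laurent_scaleE mulr1.
move=> -> [[tmO tbO mbO]|[tmV tbV]].
  rewrite over_coef_under /passage_coef /= ?tmO ?tbO ?mbO // !monoE.
  rewrite -(rmorph1 f) -!rmorphM -!rmorphB.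
  case: eqP => sides; rewrite -rmorphM.
    by rewrite under_coefB ?rmorph0 //= sides.
  rewrite under_coefBM ?rmorph0 //=.
  by move: sides; case: (l2r tm); case: (l2r tb).
case: eqP => sides.
  by rewrite /passage_coef /= tmV tbV /= sides subrr mulr0.
rewrite passage_coef_virtualM ?subrr ?mulr0 //= ?tmV ?tbV //.
by move: sides; case: (l2r tm); case: (l2r tb).
Qed.

(** * From the words of a third move to its linear system *)

Section ThirdWord.
Variables (pT pM pB : nat) (tm tb mb : passage).
Hypotheses (apTM : apart pT pM) (apTB : apart pT pB) (apMB : apart pM pB).
Hypotheses (tmU : lev tm <> Under) (tbU : lev tb <> Under) (mbU : lev mb <> Under).

Definition triangle_positions := [:: pT; pT.+1; pM; pM.+1; pB; pB.+1].

Record third_letters (fT fM fB : bool) (w : word) : Prop := ThirdLetters {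
  third_size : [/\ pT.+1 < size w, pM.+1 < size w & pB.+1 < size w]%N;
  third_lT : (letter w pT, letter w pT.+1) = if fT then (tm, tb) else (tb, tm);
  third_lM : (letter w pM, letter w pM.+1) =
    if fM then (mate tm, mb) else (mb, mate tm);
  third_lB : (letter w pB, letter w pB.+1) =
    if fB then (mate tb, mate mb) else (mate mb, mate tb)
}.

Section OneWord.
Variables (fT fM fB : bool) (w : word).
Hypotheses (wf : well_formed w) (lw : third_letters fT fM fB w).

Lemma third_index :
  [/\ index tm w = if fT then pT else pT.+1,
      index tb w = if fT then pT.+1 else pT,
      index (mate tm) w = if fM then pM else pM.+1,
      index mb w = if fM then pM.+1 else pM
    & index (mate tb) w = (if fB then pB else pB.+1) /\
      index (mate mb) w = if fB then pB.+1 else pB].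
Proof.
have [sT sM sB] := third_size lw.
have I p : (p.+1 < size w)%N ->
    index (letter w p) w = p /\ index (letter w p.+1) w = p.+1.
  by move=> pw; rewrite !index_letter // ltnW.
have [[T1 T2] [M1 M2] [B1 B2]] := And3 (I _ sT) (I _ sM) (I _ sB).
split; last split.
- by move: (third_lT lw) T1 T2; case: ifP => _ [-> ->].
- by move: (third_lT lw) T1 T2; case: ifP => _ [-> ->].
- by move: (third_lM lw) M1 M2; case: ifP => _ [-> ->].
- by move: (third_lM lw) M1 M2; case: ifP => _ [-> ->].
- by move: (third_lB lw) B1 B2; case: ifP => _ [-> ->].
- by move: (third_lB lw) B1 B2; case: ifP => _ [-> ->].
Qed.

Lemma third_edge_system :
  third_system pT pM pB (passage_coef w tm) (passage_coef w tb)
    (passage_coef w (mate tm)) (passage_coef w mb)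
    (passage_coef w (mate tb)) (passage_coef w (mate mb))
    (over_coef w (mate tm)) (over_coef w (mate tb)) (over_coef w (mate mb))
    fT fM fB (edge_C w) (edge_G w) (edge_P w) (edge_Q w).
Proof.
have [Itm Itb Imtm Imb [Imtb Immb]] := third_index.
have [lT lM lB] := And3 (third_lT lw) (third_lM lw) (third_lB lw).
split=> //=.
- by move: lT; case: ifP => _ [-> ->].
- by move: lT; case: ifP => _ [-> ->]; rewrite !over_coef0.
- by move: lM; case: ifP => _ [-> ->].
- by move: lM; case: ifP => _ [-> ->]; rewrite (over_coef0 _ mbU).
- by rewrite -Itm; move: lM; case: ifP => _ [/= l1 l2]; rewrite ?l1 ?l2 mateK.
- by move: lB; case: ifP => _ [-> ->].
- by move: lB; case: ifP => _ [-> ->].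
- by rewrite -Itb; move: lB; case: ifP => _ [/= l1 l2]; rewrite ?l1 ?l2 mateK.
- by rewrite -Imb; move: lB; case: ifP => _ [/= l1 l2]; rewrite ?l1 ?l2 mateK.
Qed.

(** The six positions hold three letters and their mates. An underpass elsewhere thus has its
    overpass elsewhere, and its relation avoids the inner edges. *)
Lemma triangle_position_mate k : (k < size w)%N ->
  (index (mate (letter w k)) w \in triangle_positions) = (k \in triangle_positions).
Proof.
have [Itm Itb Imtm Imb [Imtb Immb]] := third_index.
have [lT lM lB] := And3 (third_lT lw) (third_lM lw) (third_lB lw).
have closed l : l \in triangle_positions ->
    index (mate (letter w l)) w \in triangle_positions.
  have L : letter w l \in [:: tm; tb; mate tm; mb; mate tb; mate mb] ->
      index (mate (letter w l)) w \in triangle_positions.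
    rewrite !inE => /or4P[|||/or3P[]] /eqP ->;
    rewrite ?mateK ?Itm ?Itb ?Imtm ?Imb ?Imtb ?Immb;
    by case: ifP => _; rewrite eqxx ?orbT.
  move=> lE; apply: L; move: lE; rewrite /triangle_positions !inE.
  move=> /or4P[|||/or3P[]] /eqP ->;
  [move: lT | move: lT | move: lM | move: lM | move: lB | move: lB];
  by case: ifP => _ [l1 l2]; rewrite ?l1 ?l2 eqxx ?orbT.
move=> kw; apply/idP/idP; last exact: closed.
move/closed; rewrite letter_index ?mem_mate ?mem_nth // mateK.
by rewrite index_letter.
Qed.
End OneWord.

(** Beyond the letter itself, only its order relative to its mate matters. The two lie on different
    strands, and each moves only within its own pair of positions. *)
Lemma passage_coef_third fT fM fB fT' fM' fB' w w' a :
  well_formed w -> third_letters fT fM fB w ->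
  well_formed w' -> third_letters fT' fM' fB' w' ->
  a \in [:: tm; tb; mate tm; mb; mate tb; mate mb] ->
  passage_coef w' a = passage_coef w a.
Proof.
move=> wf lw wf' lw'.
have [Itm Itb Imtm Imb [Imtb Immb]] := third_index wf lw.
have [Jtm Jtb Jmtm Jmb [Jmtb Jmmb]] := third_index wf' lw'.
have B p b : (p <= (if b then p else p.+1) <= p.+1)%N by case: b; lia.
have B' p b : (p <= (if b then p.+1 else p) <= p.+1)%N by case: b; lia.
have apC p p' : apart p p' -> apart p' p by rewrite /apart orbC.
rewrite /passage_coef /under_coef => aE.
suff -> : (index (mate a) w' < index a w')%N = (index (mate a) w < index a w)%N by [].
move: aE; rewrite !inE => /or4P[|||/or3P[]] /eqP ->;
rewrite ?mateK ?Itm ?Itb ?Imtm ?Imb ?Imtb ?Immb ?Jtm ?Jtb ?Jmtm ?Jmb ?Jmtb ?Jmmb.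
- by rewrite !(@apart_lt pM pT) // apC.
- by rewrite !(@apart_lt pB pT) // apC.
- by rewrite !(@apart_lt pT pM).
- by rewrite !(@apart_lt pB pM) // apC.
- by rewrite !(@apart_lt pT pB).
- by rewrite !(@apart_lt pM pB).
Qed.

Lemma edge_det_third fT fM fB w w' :
  well_formed w -> third_letters fT fM fB w ->
  well_formed w' -> third_letters (~~ fT) (~~ fM) (~~ fB) w' ->
  size w' = size w ->
  (forall k, k \notin triangle_positions -> letter w' k = letter w k) ->
  (fM == fB) = (l2r tm == l2r tb) ->
  [/\ lev tm = Over, lev tb = Over & lev mb = Over] \/
    lev tm = Virtual /\ lev tb = Virtual ->
  edge_det w' = edge_det w.
Proof.
move=> wf lw wf' lw' sw same sides levels.
have sys := third_edge_system wf lw.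
have sys' := third_edge_system wf' lw'.
have coefE := passage_coef_third wf lw wf' lw'.
have overE a : a \in [:: tm; tb; mate tm; mb; mate tb; mate mb] ->
    over_coef w' a = over_coef w a.
  by move=> aE; rewrite /over_coef coefE.
rewrite !coefE ?overE ?inE ?eqxx ?orbT // in sys'.
(* Position [k] owns relation [k.+1], so the positions of the triangle correspond to [mids] and
   [outs] shifted by one; [midE] instead reads [k] as the edge entering that position. *)
have posE k : (k.+1 \in mids pT pM pB ++ outs pT pM pB) = (k \in triangle_positions).
  by rewrite /triangle_positions !inE !eqSS; do ![case: eqP => //=].
have midE k : k \notin triangle_positions -> k \notin mids pT pM pB.
  by rewrite /triangle_positions /mids !inE !negb_or => /and5P[_ -> _ -> /andP[_ ->]].
have [sT sM sB] := third_size lw.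
have eE : edges w' = edges w by rewrite /edges sw.
have us : uniq (edges w) by exact: iota_uniq.
have ms : {subset mids pT pM pB <= edges w}.
  by move=> x; rewrite mem_edges !inE => /or3P[] /eqP ->; apply: ltnW.
have PQ := edge_PQ wf.
have PQ' := edge_PQ wf'; rewrite eE in PQ'.
have away : {in edges w, forall x, x \notin mids pT pM pB ++ outs pT pM pB ->
    edge_P w x \notin mids pT pM pB /\ edge_Q w x \notin mids pT pM pB}.
  move=> [|k]; rewrite mem_edges => kw.
    by split=> //; rewrite [edge_P _ _]/(size w) !inE !gtn_eqF.
  rewrite posE => kt; split; first exact: midE.
  apply: midE; rewrite [edge_Q _ _]/(index (mate (letter w k)) w).
  by rewrite (triangle_position_mate wf lw).
have same' : {in edges w, forall x, x \notin mids pT pM pB ++ outs pT pM pB ->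
    [/\ edge_C w x = edge_C w' x, edge_G w x = edge_G w' x,
        edge_P w x = edge_P w' x & edge_Q w x = edge_Q w' x]}.
  move=> [|k]; rewrite mem_edges => kw; first by rewrite /= sw.
  rewrite posE => kt; rewrite /= (same _ kt).
  set a := letter w k.
  have aw : a \in w by rewrite mem_nth.
  have Iw b : b \in w -> index b w \notin triangle_positions -> index b w' = index b w.
    move=> bw bt; rewrite -{1}(letter_index bw) -same // index_letter ?sw ?index_mem //.
  have Ima : index (mate a) w' = index (mate a) w.
    by apply: Iw; rewrite ?mem_mate // (triangle_position_mate wf lw).
  have Ia : index a w' = index a w by apply: Iw; rewrite ?index_letter.
  have ca : passage_coef w' a = passage_coef w a.
    by rewrite /passage_coef /under_coef Ima Ia.
  by rewrite Ima /over_coef ca.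
rewrite /edge_det eE; apply/esym.
apply: (third_invariance apTM apTB apMB sys sys' us ms PQ PQ' away same').
- exact: third_relation.
- case: levels => [[tmO tbO mbO]|[tmV tbV]]; [left|right].
    split; last (split; apply: over_coef_under; rewrite /= ?tmO ?tbO ?mbO //).
    - exact: passage_coef_over.
    - exact: passage_coef_over.
    - exact: passage_coef_over.
  by split; apply: over_coef0; rewrite /= ?tmV ?tbV.
Qed.

End ThirdWord.

(* As in [third_word], but the cyclic order of the three pairs of positions is
   irrelevant, so that the strands can be permuted cyclically. *)
Record cyclic_letters (p1 p2 p3 : nat) (x y z : passage) (f1 f2 f3 : bool)
    (w : word) : Prop := CyclicLetters {
  cyclic_size : [/\ p1.+1 < size w, p2.+1 < size w & p3.+1 < size w]%N;
  cyclic_l1 : (letter w p1, letter w p1.+1) = if f1 then (x, mate z) else (mate z, x);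
  cyclic_l2 : (letter w p2, letter w p2.+1) = if f2 then (y, mate x) else (mate x, y);
  cyclic_l3 : (letter w p3, letter w p3.+1) = if f3 then (z, mate y) else (mate y, z)
}.

Lemma cyclic_lettersC p1 p2 p3 x y z f1 f2 f3 w :
  cyclic_letters p1 p2 p3 x y z f1 f2 f3 w ->
  cyclic_letters p2 p3 p1 y z x f2 f3 f1 w.
Proof. by case=> -[s1 s2 s3] l1 l2 l3. Qed.

Lemma triangleC x y z f1 f2 f3 : triangle x y z f1 f2 f3 -> triangle y z x f2 f3 f1.
Proof. by rewrite /triangle => /and3P[-> -> ->]. Qed.

Definition same_outside (p1 p2 p3 : nat) (w w' : word) := forall k,
  [/\ k != p1, k != p2 & k != p3] -> [/\ k != p1.+1, k != p2.+1 & k != p3.+1] ->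
  letter w' k = letter w k.

Lemma same_outsideC p1 p2 p3 w w' :
  same_outside p1 p2 p3 w w' -> same_outside p2 p3 p1 w w'.
Proof. by move=> same k [k1 k2 k3] [l1 l2 l3]; apply: same. Qed.

(* The second alternative allows the crossing y of the two other strands to be
   classical or virtual. *)
Definition first_on_top (x y z : passage) :=
  [/\ lev x = Over, lev z = Under & lev y <> Virtual] \/
  lev x = Virtual /\ lev z = Virtual.

(** Strand 1 is the top. The middle is strand 3 if strand 2 passes under it at [y], and strand 2
    otherwise; a bit is negated where the cyclic and the layered conventions start from different
    passages. *)
Lemma edge_det_first_on_top p1 p2 p3 x y z f1 f2 f3 w w' :
  apart p1 p2 -> apart p1 p3 -> apart p2 p3 ->
  well_formed w -> cyclic_letters p1 p2 p3 x y z f1 f2 f3 w ->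
  well_formed w' -> cyclic_letters p1 p2 p3 x y z (~~ f1) (~~ f2) (~~ f3) w' ->
  size w' = size w -> same_outside p1 p2 p3 w w' ->
  triangle x y z f1 f2 f3 -> first_on_top x y z ->
  edge_det w' = edge_det w.
Proof.
move=> a12 a13 a23 wf [sz l1 l2 l3] wf' [sz' l1' l2' l3'] sw same tri top.
have [sz1 sz2 sz3] := sz; have [sz1' sz2' sz3'] := sz'.
have a32 : apart p3 p2 by rewrite /apart orbC.
have xU : lev x <> Under by case: top => [[->]|[->]].
have zO : lev (mate z) <> Under by rewrite /=; case: top => [[_ ->]|[_ ->]].
case: (eqVneq (lev y) Under) => [yU|yU].
- apply: (@edge_det_third p1 p3 p2 (mate z) x (mate y) a13 a12 a32 _ _ _
    (~~ f1) f3 (~~ f2)) => //=.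
  + by rewrite yU.
  + by split; rewrite ?mateK ?negbK //; [move: l1; case: (f1) | move: l2; case: (f2)].
  + by split; rewrite ?mateK ?negbK //; [move: l1'; case: (f1) | move: l2'; case: (f2)].
  + move=> k; rewrite /triangle_positions !inE !negb_or.
    by move=> /and5P[? ? ? ? /andP[]]; move=> *; apply: same.
  + move: tri; rewrite /triangle /= => /and3P[].
    by case: (l2r x); case: (l2r z); case: (f2); case: (f3).
  + case: top => [[-> -> _]|[-> ->]]; [left|right] => //.
    by rewrite yU.
- apply: (@edge_det_third p1 p2 p3 x (mate z) y a12 a13 a23 _ _ _
    f1 (~~ f2) f3) => //=.
  + by apply/eqP.
  + by split; rewrite ?mateK ?negbK //; move: l2; case: (f2).
  + by split; rewrite ?mateK ?negbK //; move: l2'; case: (f2).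
  + move=> k; rewrite /triangle_positions !inE !negb_or.
    by move=> /and5P[? ? ? ? /andP[]]; move=> *; apply: same.
  + move: tri; rewrite /triangle /= => /and3P[].
    by case: (l2r x); case: (l2r z); case: (f2); case: (f3).
  + case: top => [[-> -> yV]|[-> ->]]; [left|right] => //.
    by split=> //; case: (lev y) yU yV.
Qed.

Lemma edge_det_cyclic p1 p2 p3 x y z f1 f2 f3 w w' :
  apart p1 p2 -> apart p1 p3 -> apart p2 p3 ->
  well_formed w -> cyclic_letters p1 p2 p3 x y z f1 f2 f3 w ->
  well_formed w' -> cyclic_letters p1 p2 p3 x y z (~~ f1) (~~ f2) (~~ f3) w' ->
  size w' = size w -> same_outside p1 p2 p3 w w' ->
  triangle x y z f1 f2 f3 ->
  [\/ first_on_top x y z, first_on_top y z x | first_on_top z x y] ->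
  edge_det w' = edge_det w.
Proof.
move=> a12 a13 a23 wf l wf' l' sw same tri.
have apC p p' : apart p p' -> apart p' p by rewrite /apart orbC.
have [a21 a31 a32] := And3 (apC _ _ a12) (apC _ _ a13) (apC _ _ a23).
case; first exact: (edge_det_first_on_top a12 a13 a23 wf l wf' l').
  by apply: (edge_det_first_on_top a23 a21 a31 wf (cyclic_lettersC l) wf'
    (cyclic_lettersC l')) => //; [exact: same_outsideC|exact: triangleC].
apply: (edge_det_first_on_top a31 a32 a12 wf (cyclic_lettersC (cyclic_lettersC l)) wf'
    (cyclic_lettersC (cyclic_lettersC l'))) => //.
  exact/same_outsideC/same_outsideC.
exact/triangleC/triangleC.
Qed.

(** Three classical crossings without cyclic layering have a strand above both others. With two or
    three virtual crossings, some strand meets both others virtually, and it serves as the top. *)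
Lemma some_strand_on_top x y z :
  num_virtual x y z = 0%N /\ layered x y z \/ num_virtual x y z = 3 \/
    num_virtual x y z = 2 ->
  [\/ first_on_top x y z, first_on_top y z x | first_on_top z x y].
Proof.
rewrite /num_virtual /layered /first_on_top /=.
case: (lev x); case: (lev y); case: (lev z) => /=;
  case=> [[//]|[//|//]] *; try (by constructor 1; left); try (by constructor 1; right);
  try (by constructor 2; left); try (by constructor 2; right);
  try (by constructor 3; left); try (by constructor 3; right).
Qed.

Lemma letter_third (s0 s1 s2 s3 : word) a b c d e f :
  let w := s0 ++ [:: a; b] ++ s1 ++ [:: c; d] ++ s2 ++ [:: e; f] ++ s3 in
  let p1 := size s0 in let p2 := (p1.+2 + size s1)%N in
  let p3 := (p2.+2 + size s2)%N in
  [/\ (letter w p1, letter w p1.+1) = (a, b),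
      (letter w p2, letter w p2.+1) = (c, d),
      (letter w p3, letter w p3.+1) = (e, f)
    & size w = (p3.+2 + size s3)%N].
Proof.
move=> w p1 p2 p3.
have at_cat (s t : word) g h k : k = size s ->
    (letter (s ++ [:: g; h] ++ t) k, letter (s ++ [:: g; h] ++ t) k.+1) = (g, h).
  move=> ->; rewrite /letter !(nth_cat _ s) ltnn subnn.
  have -> : ((size s).+1 < size s)%N = false by lia.
  by rewrite subSnn.
split.
- exact: at_cat.
- have -> : w = (s0 ++ [:: a; b] ++ s1) ++ [:: c; d] ++ s2 ++ [:: e; f] ++ s3.
    by rewrite /w -!catA.
  by apply: at_cat; rewrite !size_cat /=; lia.
- have -> : w = (s0 ++ [:: a; b] ++ s1 ++ [:: c; d] ++ s2) ++ [:: e; f] ++ s3.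
    by rewrite /w -!catA.
  by apply: at_cat; rewrite !size_cat /=; lia.
- by rewrite /w !size_cat /=; lia.
Qed.

Lemma same_outside_third (s0 s1 s2 s3 : word) a b c d e f a' b' c' d' e' f' :
  let p1 := size s0 in let p2 := (p1.+2 + size s1)%N in
  same_outside p1 p2 (p2.+2 + size s2)%N
    (s0 ++ [:: a; b] ++ s1 ++ [:: c; d] ++ s2 ++ [:: e; f] ++ s3)
    (s0 ++ [:: a'; b'] ++ s1 ++ [:: c'; d'] ++ s2 ++ [:: e'; f'] ++ s3).
Proof.
have skip (s t t' : word) g h g' h' k : k != size s -> k != (size s).+1 ->
    (size s + 2 <= k -> letter t' (k - (size s + 2)) = letter t (k - (size s + 2)))%N ->
    letter (s ++ [:: g'; h'] ++ t') k = letter (s ++ [:: g; h] ++ t) k.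
  move=> k0 k1 tE; rewrite /letter !nth_cat; case: ltnP => // sk.
  have sk2 : (size s + 2 <= k)%N by move: k0 k1 => /eqP ? /eqP; lia.
  have -> : (k - size s < size [:: g; h])%N = false by rewrite /=; lia.
  by rewrite /= -subnDA; apply: tE.
move=> p1 p2 k [/eqP k1 /eqP k2 /eqP k3] [/eqP l1 /eqP l2 /eqP l3].
apply: (skip); [exact/eqP | exact/eqP | move=> le1].
apply: (skip); [apply/eqP; rewrite /p1 /p2 in k2 *; lia |
  apply/eqP; rewrite /p1 /p2 in l2 *; lia | move=> le2].
apply: (skip); [apply/eqP; rewrite /p1 /p2 in k3 *; lia |
  apply/eqP; rewrite /p1 /p2 in l3 *; lia | by []].
Qed.

Lemma edge_det_Omega3 u0 u1 u2 u3 x y z f1 f2 f3 :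
  well_formed (third_word u0 u1 u2 u3 x y z f1 f2 f3) ->
  well_formed (third_word u0 u1 u2 u3 x y z (~~ f1) (~~ f2) (~~ f3)) ->
  triangle x y z f1 f2 f3 ->
  [\/ first_on_top x y z, first_on_top y z x | first_on_top z x y] ->
  edge_det (third_word u0 u1 u2 u3 x y z (~~ f1) (~~ f2) (~~ f3)) =
  edge_det (third_word u0 u1 u2 u3 x y z f1 f2 f3).
Proof.
have ordE f (a b : passage) : ordered f a b = [:: if f then a else b; if f then b else a].
  by case: f.
have pairE f (a b : passage) : (if f then a else b, if f then b else a) =
    if f then (a, b) else (b, a) by case: f.
set p1 := size u0; pose p2 := (p1.+2 + size u1)%N; pose p3 := (p2.+2 + size u2)%N.
move=> wf wf' tri top.
have lettersE g1 g2 g3 : cyclic_letters p1 p2 p3 x y z g1 g2 g3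
    (third_word u0 u1 u2 u3 x y z g1 g2 g3).
  rewrite /third_word !ordE; have [l1 l2 l3 sz] := letter_third u0 u1 u2 u3
    (if g1 then x else mate z) (if g1 then mate z else x)
    (if g2 then y else mate x) (if g2 then mate x else y)
    (if g3 then z else mate y) (if g3 then mate y else z).
  by split; rewrite ?l1 ?l2 ?l3 ?pairE // sz; split; lia.
apply: (@edge_det_cyclic p1 p2 p3 x y z f1 f2 f3) => //;
  try (by rewrite /apart /p3 /p2; lia).
- by rewrite /third_word !size_cat !ordE.
- by rewrite /third_word !ordE; apply: same_outside_third.
Qed.

(** * Invariance *)

Lemma edge_det_renaming (h : nat -> nat) (w : word) : injective h -> well_formed w ->
  edge_det [seq Passage (h (crossing a)) (lev a) (l2r a) | a <- w] = edge_det w.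
Proof.
move=> inj_h wf; pose f a := Passage (h (crossing a)) (lev a) (l2r a).
have inj_f : injective f by case=> c l b [c' l' b'] [/inj_h -> -> ->].
rewrite -[[seq _ | _ <- _]]/(map f w).
have idx a : index (f a) (map f w) = index a w by exact: index_map.
have mateE a : mate (f a) = f (mate a) by [].
have coefE a : passage_coef (map f w) (f a) = passage_coef w a.
  by rewrite /passage_coef /under_coef mateE !idx.
rewrite /edge_det /edges size_map; apply: eq_label_det => x y.
rewrite mem_iota add0n ltnS => xw _; rewrite /edge_system /sparse.
case: x xw => [|k] kw; first by rewrite /edge_P size_map.
have lE : letter (map f w) k = f (letter w k) by exact: nth_map.
by rewrite /= lE mateE idx /over_coef coefE.
Qed.

Lemma edge_det_move (w w' : word) : well_formed w -> well_formed w' -> move w w' ->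
  exists r, edge_det w' = q_ r *: edge_det w.
Proof.
have eq_scale (u v : laurent T) : u = v -> exists r, u = q_ r *: v.
  by move=> ->; exists 0; rewrite q_0 scale1r.
move=> wf wf' ww'; case: ww' wf wf' => {w w'}.
- by move=> h w inj_h wf _; apply: eq_scale; apply: edge_det_renaming.
- by move=> u v a; apply: edge_det_Omega1.
- by move=> u v w a b parallel lab ab wf wf'; apply: eq_scale; apply: edge_det_Omega2.
- move=> u0 u1 u2 u3 x y z f1 f2 f3 tri num lay wf wf'; apply: eq_scale.
  by apply: edge_det_Omega3 => //; apply: some_strand_on_top; left.
- move=> u0 u1 u2 u3 x y z f1 f2 f3 tri num wf wf'; apply: eq_scale.
  by apply: edge_det_Omega3 => //; apply: some_strand_on_top; right; left.
- move=> u0 u1 u2 u3 x y z f1 f2 f3 tri num wf wf'; apply: eq_scale.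
  by apply: edge_det_Omega3 => //; apply: some_strand_on_top; right; right.
Qed.

Theorem theorem1p1 (D D' : diagram) :
  (0 < size (classical_crossings D))%N ->
  (0 < size (classical_crossings D'))%N ->
  equivalent D D' ->
  exists r : int, zeta D' = q_ r *: zeta D.
Proof.
have wf (E : diagram) : well_formed E by case: E.
(* Passing to [edge_det] before the induction matters: intermediate diagrams may have no classical
   crossing, and [edge_det] transforms correctly there too. *)
move=> cD cD'; rewrite !zeta_edge_det // => {cD cD'}.
elim=> {D D'} [D D'|D|D D' _ [r ->]|D D' D'' _ [r ->] _ [r' ->]].
- exact: edge_det_move.
- by exists 0; rewrite q_0 scale1r.
- by exists (- r); rewrite scalerA -q_D addNr q_0 scale1r.
- by exists (r' + r); rewrite scalerA -q_D.
Qed.
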